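(* Let $\delta\in(0,1)$, $\alpha\ge2$, and assume Assumptions (A1) and (SG). Set $\lambda_j^{(r)}=\sqrt{\log(2re/j)}$, $\eta=12\alpha LM\sqrt{\log(2/\delta)/n}$, $\lambda=\eta\lambda^{(p)}_{k^*}$, and $\lambda_G=\eta\lambda^{(G)}_{s^*}+\alpha LM\sqrt{\gamma m^*/(s^*n)}$, where $\gamma\ge1$ satisfies $m_0\le\gamma m^*$. Then each of the following holds with probability at least $1-\delta/2$: (1) If $\hat\beta_1$ is a solution of $\min_{\|\beta\|_1\le2R}\frac1n\sum_if(\langle x_i,\beta\rangle;y_i)+\lambda\|\beta\|_1$, $h_1=\hat\beta_1-\beta^*$ and $S_0$ is the set of indices of the $k^*$ largest entries of $h_1$ in absolute value, then $h_1\in\Lambda(S_0,\frac{\alpha}{\alpha-1},\frac{\sqrt{k^*}}{\alpha-1})$. (2) If $\hat\beta_{\mathcal S}$ is a solution of $\min_{\|\beta\|_1\le2R}\frac1n\sum_if(\langle x_i,\beta\rangle;y_i)+\eta\sum_{j=1}^p\lambda^{(p)}_j|\beta_{(j)}|$, then $h_{\mathcal S}=\hat\beta_{\mathcal S}-\beta^*\in\Gamma(k^*,\frac{\alpha+1}{\alpha-1})$. (3) If $\hat\beta_{L1-L2}$ is a solution of $\min_{\|\beta\|_1\le2R}\frac1n\sum_if(\langle x_i,\beta\rangle;y_i)+\lambda_G\sum_{g=1}^G\|\beta_g\|_2$, $h_{L1-L2}=\hat\beta_{L1-L2}-\beta^*$, and $\mathcal J_0$ is the set of indices of the $s^*$ groups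 $g$ with largest $\|(h_{L1-L2})_g\|_2$, then $h_{L1-L2}\in\Omega(\mathcal J_0,\frac{\alpha}{\alpha-1},\frac{\sqrt{s^*}}{\alpha-1})$.
   Context: Data: $(x_i,y_i)$, $i=1,\dots,n$, independent samples from a distribution on $\mathbb R^p\times\mathcal Y$; $(x,y)$ a generic draw. Assumption (A1): for each $y$, $f(\cdot;y)$ is non-negative, convex, $L$-Lipschitz, and there is $\partial f(\cdot,y)$ with $f(t_2,y)-f(t_1,y)\ge\partial f(t_1,y)(t_2-t_1)$ for all $t_1,t_2$. $\beta^*$ is a minimizer of $\mathcal L(\beta)=\mathbb Ef(\langle x,\beta\rangle;y)$, $k^*=\|\beta^*\|_0$, $R=\|\beta^*\|_1$. A real $Z$ is $\mathrm{subG}(\sigma^2)$ if $\mathbb EZ=0$ and $\mathbb Ee^{tZ}\le e^{\sigma^2t^2/2}$ for all $t>0$; a random vector $Z$ is $\mathrm{subG}(\sigma^2)$ if $\mathbb Ee^{tu^TZ}\le e^{\sigma^2t^2\|u\|_2^2/2}$ for all $u$, $t>0$. Assumption (SG): there is $M>0$ such that $\partial f(\langle x_i,\beta^*\rangle,y_i)x_{ij}\sim\mathrm{subG}(L^2M^2)$ for all $i,j$ and, for the group estimator, $\partial f(\langle x_i,\beta^*\rangle,y_i)(x_i)_g\sim\mathrm{subG}(L^2M^2)$ for all $i,g$. Groups: disjoint $\mathcal I_1,\dots,\mathcal I_G$ partitioning $\{1,\dots,p\}$, $n_g=|\mathcal I_g|$, $\beta_g$ the restriction of $\beta$ to $\mathcal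 I_g$; $\mathcal J^*$ the smallest set of groups whose union contains the support of $\beta^*$, $s^*=|\mathcal J^*|$, $m^*=\sum_{g\in\mathcal J^*}n_g$; $m_0$ the total size of the $s^*$ largest groups; $\mathcal T(\mathcal J)=\cup_{g\in\mathcal J}\mathcal I_g$. For a vector $z$, $|z_{(1)}|\ge\dots\ge|z_{(p)}|$ is a non-increasing rearrangement of its absolute entries. Cones: $\Lambda(S,\gamma_1,\gamma_2)=\{z:\|z_{S^c}\|_1\le\gamma_1\|z_S\|_1+\gamma_2\|z_S\|_2\}$; $\Gamma(k,\omega)=\{z:\sum_{j=k+1}^p\lambda_j^{(p)}|z_{(j)}|\le\omega\sum_{j=1}^k\lambda_j^{(p)}|z_{(j)}|\}$; $\Omega(\mathcal J,\epsilon_1,\epsilon_2)=\{z:\sum_{g\notin\mathcal J}\|z_g\|_2\le\epsilon_1\sum_{g\in\mathcal J}\|z_g\|_2+\epsilon_2\|z_{\mathcal T(\mathcal J)}\|_2\}$.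
   Formalization: Parts (1) and (2) also assume the vector sub-Gaussian bound on the groups (for singleton groups: the scalar bound for all real t), since the scalar bound for t>0 only does not control the lower tail and (1) then fails; also L>0 and k*≥1 are assumed. *)

(* Defs.v *)
From HB Require Import structures.
From mathcomp Require Import all_boot all_order all_algebra.
From mathcomp Require Import all_classical all_reals all_analysis.
Set Implicit Arguments. Unset Strict Implicit. Unset Printing Implicit Defensive.
Import Order.TTheory GRing.Theory Num.Theory.
Import numFieldNormedType.Exports.
Local Open Scope classical_set_scope.
Local Open Scope ring_scope.

Section Defs.
Variable R : realType.

Definition dotv (p : nat) (x b : 'I_p -> R) : R := \sum_(j < p) x j * b j.
Definition norm1 (p : nat) (b : 'I_p -> R) : R := \sum_(j < p) `|b j|.
Definition norm0 (p : nat) (b : 'I_p -> R) : nat := #|[set j | b j != 0]|.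

Definition lamseq (r j : nat) : R :=
  Num.sqrt (ln (2 * r%:R * expR 1 / j%:R)).

Definition sorted_abs (p : nat) (z : 'I_p -> R) : seq R :=
  sort (fun a b : R => b <= a) [seq `|z j| | j <- enum 'I_p].

(* sum_{j = a+1}^{b} lambda_j^{(p)} |z_(j)|  (1-based j) *)
Definition slope_part (p : nat) (z : 'I_p -> R) (a b : nat) : R :=
  \sum_(a <= i < b) lamseq p i.+1 * nth 0 (sorted_abs z) i.

Definition slope_norm (p : nat) (b : 'I_p -> R) : R := slope_part b 0 p.

Definition Lambda_cone (p : nat) (S : {set 'I_p}) (g1 g2 : R) (z : 'I_p -> R) :=
  \sum_(j in ~: S) `|z j| <= g1 * \sum_(j in S) `|z j|
                             + g2 * Num.sqrt (\sum_(j in S) z j ^+ 2).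

Definition Gamma_cone (p k : nat) (om : R) (z : 'I_p -> R) :=
  slope_part z k p <= om * slope_part z 0 k.

(* groups: grp j = index of the group containing coordinate j *)
Definition grpnorm (p G : nat) (grp : 'I_p -> 'I_G) (z : 'I_p -> R) (g : 'I_G) : R :=
  Num.sqrt (\sum_(j < p | grp j == g) z j ^+ 2).

Definition gsize (p G : nat) (grp : 'I_p -> 'I_G) (g : 'I_G) : nat :=
  #|[set j | grp j == g]|.

Definition Omega_cone (p G : nat) (grp : 'I_p -> 'I_G) (J : {set 'I_G})
    (e1 e2 : R) (z : 'I_p -> R) :=
  \sum_(g in ~: J) grpnorm grp z g <= e1 * \sum_(g in J) grpnorm grp z g
     + e2 * Num.sqrt (\sum_(j < p | grp j \in J) z j ^+ 2).

(* smallest set of groups whose union contains the support of b *)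
Definition Jsupp (p G : nat) (grp : 'I_p -> 'I_G) (b : 'I_p -> R) : {set 'I_G} :=
  [set g | [exists j, (grp j == g) && (b j != 0)]].

(* total size of the s largest groups *)
Definition m0_of (p G : nat) (grp : 'I_p -> 'I_G) (s : nat) : nat :=
  \max_(J : {set 'I_G} | #|J| == s) \sum_(g in J) gsize grp g.

Definition A1 (Y : Type) (f : R -> Y -> R) (df : R -> Y -> R) (L : R) :=
  forall y : Y,
    (forall t, 0 <= f t y) /\
    (forall a b (t : R), 0 <= t <= 1 ->
        f (t * a + (1 - t) * b) y <= t * f a y + (1 - t) * f b y) /\
    (forall a b, `|f a y - f b y| <= L * `|a - b|) /\
    (forall t1 t2, f t2 y - f t1 y >= df t1 y * (t2 - t1)).

Definition subG d (Om : measurableType d) (P : probability Om R)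
    (X : Om -> R) (s2 : R) :=
  P.-integrable setT (EFin \o X) /\
  (\int[P]_w (X w)%:E = 0)%E /\
  forall t : R, 0 < t ->
    (\int[P]_w (expR (t * X w))%:E <= (expR (s2 * t ^+ 2 / 2))%:E)%E.

Definition subG_vec d (Om : measurableType d) (P : probability Om R) (p : nat)
    (A : {set 'I_p}) (X : Om -> 'I_p -> R) (s2 : R) :=
  forall (u : 'I_p -> R) (t : R), 0 < t ->
    (\int[P]_w (expR (t * \sum_(j in A) u j * X w j))%:E
       <= (expR (s2 * t ^+ 2 * (\sum_(j in A) u j ^+ 2) / 2))%:E)%E.

Definition mutually_indep d (Om : measurableType d) (P : probability Om R)
    dZ (Z : measurableType dZ) (n : nat) (W : 'I_n -> Om -> Z) :=
  forall A : 'I_n -> set Z, (forall i, measurable (A i)) ->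
    P (\bigcap_(i in [set: 'I_n]) (W i @^-1` A i))
      = (\prod_(i < n) P (W i @^-1` A i))%E.

Definition solves (p : nat) (F : ('I_p -> R) -> R) (Rad : R) (bh : 'I_p -> R) :=
  norm1 bh <= 2 * Rad /\
  forall b, norm1 b <= 2 * Rad -> F bh <= F b.

End Defs.
Arguments lamseq {R}.

(* Main.v *)
Require Import Defs.
From HB Require Import structures.
From mathcomp Require Import all_boot all_order all_algebra.
From mathcomp Require Import all_classical all_reals all_analysis.
From mathcomp Require Import ring lra measurable_realfun.
Import Order.TTheory GRing.Theory Num.Theory.
Import numFieldNormedType.Exports.
Local Open Scope classical_set_scope.
Local Open Scope ring_scope.

(** Convexity and optimality of the estimator bound the increase of the penalty
by the inner product of [h] with the score [S], the average of the subgradient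
terms at [bstar], normalised below to unit variance proxy.  On an event that
controls [S] the score is absorbed by a fraction [1 / alpha] of the penalty,
and comparing the penalty at [bh] and at [bstar] gives the cones.

A Gaussian average turns a bound on the moment generating function into
[E exp (c |S_g|^2 / 2) <= (1 - c)^(- n_g / 2)]; choosing [c] as a function of
[t] yields [E exp (t (|S_g| - sqrt n_g)) <= exp (t^2 / 2)], so the excess of a
group norm over [sqrt n_g] is sub-Gaussian with a constant that does not depend
on [n_g].  Writing [U_i] for the [|S_j|], resp. for these excesses, a second
average gives [E exp (U_i^2 / 4) <= 3].  By Markov's inequality
[sum_i exp (U_i^2 / 4) <= 6 N / delta] outside an event of probability at most
[delta / 2], and then Jensen's inequality bounds the mean of [U_i^2] over every
set of [m] indices by [4 log (6 N / (delta m))] at once, with no union bound. *)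

(** * Products of independent variables *)

Section Independence.
Variables (R : realType) (dO : measure_display) (Om : measurableType dO).
Variables (P : probability Om R) (dZ : measure_display) (Z : measurableType dZ).

Lemma measurable_set_lt (d : measure_display) (T : measurableType d)
    (f g : T -> R) : measurable_fun setT f -> measurable_fun setT g ->
  measurable [set x | f x < g x].
Proof.
move=> mf mg; rewrite (_ : [set x | _] = ~` (setT `&` [set x | g x <= f x])).
  by apply: measurableC; exact: measurable_fun_le.
apply/seteqP; split => x /=; rewrite ltNge; first by move=> /negP ? [].
by move=> H; apply/negP => ?; exact: H.
Qed.

(* Layer cake: [g * f] is the integral over [t] of [g * 1_(t < f)]. *)
Lemma ge0_integral_mul_le (g : Om -> R) (f : Om -> R) (c : R) :
  measurable_fun setT g -> (forall w, 0 <= g w) ->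
  measurable_fun setT f -> (forall w, 0 <= f w) -> 0 <= c ->
  (forall t : R, (\int[P]_w (g w * \1_[set w | (t < f w)%R] w)%:E
     <= c%:E * P [set w | (t < f w)%R])%E) ->
  (\int[P]_w (g w * f w)%:E <= c%:E * \int[P]_w (f w)%:E)%E.
Proof.
move=> mg g0 mf f0 c0 H.
(* [D] is the region under the graph of [f]. Its section over [w] is the interval from 0 to [f w],
   of Lebesgue measure [f w]. *)
pose D : set (Om * measurableTypeR R) := [set x | 0 <= x.2 /\ x.2 < f x.1].
have mD : measurable D.
  have -> : D = [set x | 0 <= x.2] `&` [set x | x.2 < f x.1] by [].
  apply: measurableI.
    rewrite -[X in measurable X]setTI.
    by apply: measurable_fun_le => //; exact: measurable_snd.
  by apply: measurable_set_lt => //; exact: measurableT_comp.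
pose mu := @lebesgue_measure R.
have fE w : (\int[mu]_t (\1_D (w, t))%:E)%E = (f w)%:E.
  rewrite (_ : (fun t => _) = (fun t => (\1_(`[0, f w[%classic) t)%:E)); last first.
    apply/funext => t; congr (_%:E); rewrite !indicE; congr (nat_of_bool _)%:R.
    apply/idP/idP; rewrite !inE/= in_itv/=.
      by move=> [-> ->].
    by move/andP.
  rewrite integral_indic//= setIT lebesgue_measure_itv/= lte_fin.
  case: ltP => [_|]; first by rewrite sube0.
  by move=> fw; congr EFin; apply/eqP; rewrite eq_le f0 fw.
have mD1 : measurable_fun setT (\1_D : Om * measurableTypeR R -> R) by exact: measurable_indic.
(* Kept general in [a], so that the same Tonelli identity rewrites both sides, with [a] equal to [g]
   and to the constant [c]. *)
have key (a : Om -> R) : measurable_fun setT a -> (forall w, 0 <= a w) ->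
  (\int[P]_w (a w * f w)%:E =
    \int[mu]_t \int[P]_w (a w * \1_D (w, t))%:E)%E.
  move=> ma a0.
  rewrite -(@fubini_tonelli _ _ Om (measurableTypeR R) R P mu (fun x => (a x.1 * \1_D x)%:E)).
  - apply: eq_integral => w _ /=; rewrite EFinM -fE -ge0_integralZl//=.
    + by apply/measurable_EFinP; exact: measurable_fun_pair2.
    + by rewrite lee_fin.
  - apply/measurable_EFinP/measurable_funM => //; exact: measurableT_comp.
  - by move=> x; rewrite lee_fin mulr_ge0.
have -> : (c%:E * \int[P]_w (f w)%:E = \int[P]_w (c * f w)%:E)%E.
  rewrite -ge0_integralZl//; [exact/measurable_EFinP|].
  by move=> w _; rewrite lee_fin.
rewrite (key g)// (key (cst c))//.
apply: ge0_le_integral => //.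
- by move=> t _; apply: integral_ge0 => w _; rewrite lee_fin mulr_ge0.
- apply: (measurable_fun_fubini_tonelli_G (fun x => (g x.1 * \1_D x)%:E)).
    apply/measurable_EFinP/measurable_funM => //; exact: measurableT_comp.
  by move=> x; rewrite lee_fin mulr_ge0.
- apply: (measurable_fun_fubini_tonelli_G (fun x => (c * \1_D x)%:E)).
    by apply/measurable_EFinP/measurable_funM.
  by move=> x; rewrite lee_fin mulr_ge0.
move=> t _.
have [t0|t0] := leP 0 t; last first.
  have D0 w : \1_D (w, t) = 0 :> R.
    rewrite indicE; case: (boolP ((w, t) \in D)) => //; rewrite inE/= => -[/=].
    by rewrite leNgt t0.
  under eq_integral do rewrite D0 mulr0.
  under [X in (_ <= X)%E]eq_integral do rewrite /= D0 mulr0.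
  by [].
have D1 w : \1_D (w, t) = \1_[set w | (t < f w)%R] w :> R.
  rewrite !indicE; congr (nat_of_bool _)%:R.
  by apply/idP/idP; rewrite !inE/= ?/D/=; [move=> []|move=> ?; split].
under eq_integral do rewrite D1.
apply: (le_trans (H t)); under [X in (_ <= X)%E]eq_integral do rewrite /= D1.
have mA : measurable [set w | (t < f w)%R].
  exact: measurable_set_lt.
under [X in (_ <= X)%E]eq_integral do rewrite EFinM.
rewrite ge0_integralZl//; first by rewrite integral_indic// setIT.
by apply/measurable_EFinP; exact: measurable_indic.
Qed.

(** Independence is given for events only. The indicators are replaced by the functions [f i] one
    coordinate at a time, each replacement being an instance of the layer-cake bound
    [ge0_integral_mul_le]. *)
Lemma integral_prod_indep_le (n : nat) (W : 'I_n -> Om -> Z)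
    (f : 'I_n -> Z -> R) (K : 'I_n -> R) :
  (forall i, measurable_fun setT (W i)) -> mutually_indep P W ->
  (forall i, measurable_fun setT (f i)) -> (forall i z, 0 <= f i z) ->
  (forall i, (\int[P]_w (f i (W i w))%:E <= (K i)%:E)%E) ->
  (\int[P]_w (\prod_(i < n) f i (W i w))%:E <= (\prod_(i < n) K i)%:E)%E.
Proof.
move=> mW indW mf f0 fK.
have K0 i : 0 <= K i.
  rewrite -lee_fin; apply: le_trans (fK i).
  by apply: integral_ge0 => w _; rewrite lee_fin.
have mWA i (A : set Z) : measurable A -> measurable (W i @^-1` A).
  by move=> mA; rewrite -[X in measurable X]setTI; exact: mW.
(* Hybrid product: the first [k] coordinates already carry [f i], the others still carry the
   indicator of [B i]; [C] is the matching bound. *)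
pose F (k : nat) (B : 'I_n -> set Z) (i : 'I_n) (w : Om) : R :=
  if (i < k)%N then f i (W i w) else \1_(B i) (W i w).
pose C (k : nat) (B : 'I_n -> set Z) (i : 'I_n) : R :=
  if (i < k)%N then K i else fine (P (W i @^-1` B i)).
have F0 k B i w : 0 <= F k B i w by rewrite /F; case: ifP.
have C0 k B i : 0 <= C k B i.
  by rewrite /C; case: ifP => // _; rewrite fine_ge0.
have mF k B i : measurable (B i) -> measurable_fun setT (F k B i).
  move=> mB; rewrite /F; case: ltnP => _; first exact: measurableT_comp.
  have mI : measurable_fun setT (\1_(B i) : Z -> R) by exact: measurable_indic.
  exact: measurableT_comp mI (mW i).
(* The sets [B] stay quantified inside the induction: the step needs the previous case with one of
   them replaced by a superlevel set. *)
have Q k : (k <= n)%N -> forall B, (forall i, measurable (B i)) ->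
    (\int[P]_w (\prod_(i < n) F k B i w)%:E <= (\prod_(i < n) C k B i)%:E)%E.
  elim: k => [_ B mB|k IH kn B mB].
    rewrite (_ : (fun w => _) =
      (fun w => (\1_(\bigcap_(i in [set: 'I_n]) (W i @^-1` B i)) w)%:E)).
      rewrite integral_indic//; last first.
        by apply: fin_bigcap_measurable => // i _; exact: mWA.
      rewrite setIT [leLHS](indW B mB) -prodEFin.
      rewrite le_eqVlt; apply/orP; left; apply/eqP; apply: eq_bigr => i _.
      by rewrite /C ltn0 fineK// fin_num_measure//; exact: mWA.
    apply/funext => w; congr EFin; rewrite indicE.
    case: (boolP (w \in _)) => [|/negP wB].
      rewrite inE => wB; rewrite big1// => i _.
      by rewrite /F ltn0 indicE mem_set//; exact: wB.
    have /existsNP[i Hi] : ~ forall i, B i (W i w).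
      by move=> H; apply: wB; rewrite inE => i _; exact: H.
    by rewrite (bigD1 i)//= {1}/F ltn0 indicE memNset// mul0r.
  pose k' := Ordinal kn.
  have Fk B' i w : i != k' -> F k.+1 B' i w = F k B' i w.
    by move=> ik; rewrite /F ltnS leq_eqVlt -[k]/(val k') (inj_eq val_inj) (negbTE ik).
  have Ck B' i : i != k' -> C k.+1 B' i = C k B' i.
    by move=> ik; rewrite /C ltnS leq_eqVlt -[k]/(val k') (inj_eq val_inj) (negbTE ik).
  have Fk' w : F k.+1 B k' w = f k' (W k' w) by rewrite /F/= ltnSn.
  have Ck' : C k.+1 B k' = K k' by rewrite /C/= ltnSn.
  pose c := \prod_(i < n | i != k') C k B i.
  pose g w := \prod_(i < n | i != k') F k B i w.
  have c0 : 0 <= c by apply: prodr_ge0.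
  rewrite (bigD1 k')//= Ck' (eq_bigr (C k B)); last by move=> i; exact: Ck.
  under eq_integral => w _.
    rewrite (bigD1 k')//= Fk' (eq_bigr (fun i => F k B i w)); last first.
      by move=> i; exact: Fk.
    rewrite mulrC; over.
  rewrite -/c mulrC EFinM.
  apply: (@le_trans _ _ (c%:E * \int[P]_w (f k' (W k' w))%:E)%E); last first.
    by apply: lee_pmul => //; apply: integral_ge0 => w _; rewrite lee_fin.
  apply: (@ge0_integral_mul_le g (fun w => f k' (W k' w))) => //.
  - rewrite /g; under eq_fun do rewrite -big_filter.
    by apply: measurable_prod => i _; exact: mF.
  - by move=> w; apply: prodr_ge0.
  - exact: measurableT_comp.
  - move=> t.
    pose A := [set z | (t < f k' z)%R].
    have mA : measurable A.
      exact: measurable_set_lt.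
    (* At stage [k] coordinate [k'] still carries an indicator, which may be chosen as that of the
       superlevel set [A] of [f k']. *)
    pose B' i := if i == k' then A else B i.
    have mB' i : measurable (B' i) by rewrite /B'; case: ifP.
    have := IH (ltnW kn) B' mB'.
    rewrite (bigD1 k')//= [C k B' k']/C ltnn /B' eqxx.
    rewrite (eq_bigr (C k B)); last first.
      by move=> i /negbTE ik; rewrite /C ik.
    rewrite -/c mulrC EFinM fineK ?fin_num_measure//; last exact: mWA.
    apply: le_trans; rewrite le_eqVlt; apply/orP; left; apply/eqP; apply: eq_integral => w _.
    congr EFin; rewrite (bigD1 k')//= mulrC [F k _ k' w]/F/= ltnn eqxx.
    congr (_ * _); apply: eq_bigr => i /negbTE ik.
    by rewrite /F ik.
have := Q n (leqnn n) (fun=> setT) (fun=> measurableT).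
rewrite (eq_bigr K); last by move=> i _; rewrite /C ltn_ord.
apply: le_trans; rewrite le_eqVlt; apply/orP; left; apply/eqP; apply: eq_integral => w _.
by congr EFin; apply: eq_bigr => i _; rewrite /F ltn_ord.
Qed.
End Independence.

(** * Gaussian averages *)

Section GaussianMixing.
Variable R : realType.

Lemma ge0_integralZl_real (d : measure_display) (T : measurableType d)
    (m : {measure set T -> \bar R}) (k : R) (f : T -> R) :
  measurable_fun setT f -> (forall x, 0 <= f x) -> 0 <= k ->
  (\int[m]_x (k * f x)%:E = k%:E * \int[m]_x (f x)%:E)%E.
Proof.
move=> mf f0 k0; under eq_integral do rewrite EFinM.
by apply: ge0_integralZl => //; [exact/measurable_EFinP|move=> x _; rewrite lee_fin].
Qed.

Local Notation mu := (@lebesgue_measure R).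

Lemma normal_pdf01E (t : R) :
  normal_pdf 0 1 t = normal_peak 1 * expR (- t ^+ 2 / 2).
Proof. by rewrite normal_pdfE ?oner_eq0// /normal_fun subr0 expr1n. Qed.

(** Completing the square turns the integrand into [expR (a ^+ 2 / 2)] times the normal density of
    mean [a]. *)
Lemma integral_expR_normal_pdf (a : R) :
  (\int[mu]_t (expR (a * t) * normal_pdf 0 1 t)%:E = (expR (a ^+ 2 / 2))%:E)%E.
Proof.
under eq_integral => t _.
  rewrite (_ : _ * _ = expR (a ^+ 2 / 2) * normal_pdf a 1 t); first over.
  rewrite normal_pdf01E normal_pdfE ?oner_eq0// /normal_fun expr1n.
  rewrite mulrCA [RHS]mulrCA; congr (_ * _); rewrite -!expRD; congr expR.
  by rewrite (_ : 1 *+ 2 = 2 :> R)//; field.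
rewrite ge0_integralZl_real ?integral_normal_pdf ?mule1 ?expR_ge0//.
- exact: measurable_normal_pdf.
- exact: normal_pdf_ge0.
Qed.

(** The integrand is [s] times the centred normal density of standard deviation
    [s = (1 - c)^(-1/2)]; the factor [s] is the ratio of the two normalising constants. *)
Lemma integral_expR_sqr_normal_pdf (c : R) : c < 1 ->
  (\int[mu]_t (expR (c * t ^+ 2 / 2) * normal_pdf 0 1 t)%:E =
    ((Num.sqrt (1 - c))^-1)%:E)%E.
Proof.
move=> c1.
have c0 : 0 < 1 - c by rewrite subr_gt0.
pose s : R := (Num.sqrt (1 - c))^-1.
have s0 : 0 < s by rewrite invr_gt0 sqrtr_gt0.
have s2 : s ^+ 2 = (1 - c)^-1 by rewrite exprVn sqr_sqrtr// ltW.
have pk : normal_peak 1 = s * normal_peak s.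
  rewrite /normal_peak expr1n mul1r -mulrnAr sqrtrM ?sqr_ge0// sqrtr_sqr.
  by rewrite gtr0_norm// invfM mulrA divff ?gt_eqF// mul1r.
under eq_integral => t _.
  rewrite (_ : _ * _ = s * normal_pdf 0 s t); first over.
  rewrite normal_pdf01E normal_pdfE ?gt_eqF// /normal_fun subr0 s2 pk.
  rewrite mulrCA [RHS]mulrA; congr (_ * _); rewrite -expRD; congr expR.
  by rewrite -mulr_natr; field; rewrite gt_eqF.
rewrite ge0_integralZl_real ?integral_normal_pdf ?mule1 ?ltW//.
- exact: measurable_normal_pdf.
- exact: normal_pdf_ge0.
Qed.

Variables (dO : measure_display) (Om : measurableType dO) (P : probability Om R).

(* [expR (c * S^2 / 2)] is the average of [expR (g * sqrt c * S)] over a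
   standard Gaussian [g]. *)
Lemma integral_expR_sqr_le (V S : Om -> R) (K c : R) :
  measurable_fun setT V -> (forall w, 0 <= V w) -> measurable_fun setT S ->
  0 <= K -> 0 <= c < 1 ->
  (forall x : R, (\int[P]_w (V w * expR (x * S w))%:E
     <= (K * expR (x ^+ 2 / 2))%:E)%E) ->
  (\int[P]_w (V w * expR (c * S w ^+ 2 / 2))%:E
     <= (K * (Num.sqrt (1 - c))^-1)%:E)%E.
Proof.
move=> mV V0 mS K0 /andP[c0 c1] H.
pose F (x : Om * measurableTypeR R) : R :=
  V x.1 * expR (Num.sqrt c * x.2 * S x.1) * normal_pdf 0 1 x.2.
have F0 x : 0 <= F x by rewrite !mulr_ge0 ?expR_ge0 ?normal_pdf_ge0.
have mF : measurable_fun setT F.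
  apply: measurable_funM; last first.
    by apply: (measurableT_comp (measurable_normal_pdf 0 1)) => //; exact: measurable_snd.
  apply: measurable_funM; first exact: measurableT_comp.
  apply: measurableT_comp => //.
  apply: measurable_funM; last exact: measurableT_comp.
  by apply: measurable_funM => //; exact: measurable_snd.
have -> : (\int[P]_w (V w * expR (c * S w ^+ 2 / 2))%:E =
   \int[P]_w \int[mu]_t (F (w, t))%:E)%E.
  apply: eq_integral => w _.
  rewrite (_ : c * S w ^+ 2 = (Num.sqrt c * S w) ^+ 2); last first.
    by rewrite exprMn sqr_sqrtr.
  rewrite EFinM -integral_expR_normal_pdf -ge0_integralZl_real//.
  - apply: eq_integral => t _; rewrite /F/= mulrA.
    by rewrite [in RHS](mulrAC (Num.sqrt c)).
  - apply/measurable_funM; last exact: measurable_normal_pdf.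
    by apply: measurableT_comp => //; exact: measurable_funM.
  - by move=> t; rewrite mulr_ge0 ?expR_ge0 ?normal_pdf_ge0.
rewrite (@fubini_tonelli _ _ Om (measurableTypeR R) R P mu (fun x => (F x)%:E)) //; last first.
  exact/measurable_EFinP.
rewrite EFinM -integral_expR_sqr_normal_pdf//.
have mG : measurable_fun setT
    (fun t : measurableTypeR R => expR (c * t ^+ 2 / 2) * normal_pdf 0 1 t).
  apply/measurable_funM; last exact: measurable_normal_pdf.
  apply: measurableT_comp => //; apply: measurable_funM => //.
  by apply: measurable_funM => //; exact: measurable_funX.
rewrite -ge0_integralZl_real//; last first.
  by move=> t; rewrite mulr_ge0 ?expR_ge0 ?normal_pdf_ge0.
apply: ge0_le_integral => //.
- by move=> t _; apply: integral_ge0 => w _; rewrite lee_fin.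
- apply: (measurable_fun_fubini_tonelli_G (fun x => (F x)%:E)) => //.
  exact/measurable_EFinP.
- by apply/measurable_EFinP; exact: measurable_funM.
(* For fixed [t] the hypothesis at [x = sqrt c * t] bounds the inner integral by
   [K * expR (c * t ^+ 2 / 2)], up to the Gaussian density. *)
move=> t _ /=; rewrite /F/=.
under eq_integral do rewrite mulrC.
have mVt : measurable_fun setT (fun w => V w * expR (Num.sqrt c * t * S w)).
  apply: measurable_funM => //; apply: measurableT_comp => //.
  exact: measurable_funM.
rewrite ge0_integralZl_real ?normal_pdf_ge0//; last first.
  by move=> w; rewrite mulr_ge0 ?expR_ge0.
rewrite mulrA [X in (_ <= X%:E)%E]mulrC EFinM lee_wpmul2l ?lee_fin ?normal_pdf_ge0//.
by apply: (le_trans (H _)); rewrite exprMn sqr_sqrtr.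
Qed.

(** The coordinates are squared one at a time, each costing a factor [(1 - c)^(-1/2)]. The weight
    [V] is there for the induction: it absorbs the exponentials of the coordinates not being
    treated. *)
Lemma integral_expR_sum_sqr_le (I : eqType) (r : seq I) (S : I -> Om -> R)
    (V : Om -> R) (K c : R) :
  uniq r ->
  measurable_fun setT V -> (forall w, 0 <= V w) ->
  (forall j, measurable_fun setT (S j)) -> 0 <= K -> 0 <= c < 1 ->
  (forall v : I -> R, (\int[P]_w (V w * expR (\sum_(j <- r) v j * S j w))%:E
     <= (K * expR ((\sum_(j <- r) v j ^+ 2) / 2))%:E)%E) ->
  (\int[P]_w (V w * expR (c * (\sum_(j <- r) S j w ^+ 2) / 2))%:E
     <= (K * (Num.sqrt (1 - c))^-1 ^+ size r)%:E)%E.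
Proof.
move=> ur mV V0 mS K0 c01.
elim: r V K ur mV V0 K0 => [|i r IH] V K.
  move=> _ mV V0 K0 /(_ (fun=> 0)).
  by rewrite !big_nil mul0r expr0; under eq_integral do rewrite big_nil;
    under [X in _ -> (X <= _)%E]eq_integral do rewrite big_nil mulr0 mul0r;
    rewrite expR0.
move=> /= /andP[ir ur] mV V0 K0 H.
rewrite exprS mulrA.
under eq_integral do rewrite big_cons mulrDr mulrDl expRD mulrA.
apply: IH => //.
- apply: measurable_funM => //; apply: measurableT_comp => //.
  apply: measurable_funM => //; apply: measurable_funM => //.
  exact: measurable_funX.
- by move=> w; rewrite mulr_ge0 ?expR_ge0.
- by rewrite mulr_ge0 ?invr_ge0.
move=> v.
under eq_integral do rewrite mulrAC.
rewrite mulrAC.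
apply: integral_expR_sqr_le => //.
- apply: measurable_funM => //; apply: measurableT_comp => //.
  by apply: measurable_sum => j; exact: measurable_funM.
- by move=> w; rewrite mulr_ge0 ?expR_ge0.
- by rewrite mulr_ge0 ?expR_ge0.
move=> x.
(* Since [r] has no repetition, [i] is not in [r] and changing the vector at [i] leaves it equal to
   [v] on [r]. *)
have := H (fun j => if j == i then x else v j).
rewrite !big_cons eqxx.
have vr (F : I -> R -> R) : \sum_(j <- r) F j (if j == i then x else v j)
    = \sum_(j <- r) F j (v j).
  rewrite !big_seq; apply: eq_bigr => j jr.
  by case: eqP => // ji; rewrite -ji jr in ir.
rewrite (vr (fun _ y => y ^+ 2)) mulrDl [in X in (_ <= X)%E -> _]addrC expRD mulrA.
apply: le_trans; rewrite le_eqVlt; apply/orP; left; apply/eqP.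
apply: eq_integral => w _; congr EFin.
rewrite big_cons eqxx (vr (fun j y => y * S j w)).
by rewrite addrC expRD mulrA.
Qed.

End GaussianMixing.

(** * Concentration *)

Section Concentration.
Variables (R : realType) (dO : measure_display) (Om : measurableType dO).
Variable P : probability Om R.

Lemma measurable_fun_sqrtr (f : Om -> R) : measurable_fun setT f ->
  measurable_fun setT (fun w => Num.sqrt (f w)).
Proof.
move=> mf; apply: measurableT_comp mf.
by apply: continuous_measurable_fun; exact: sqrt_continuous.
Qed.

(** With [q] the square root of the dimension, [t * (|S| - q)] lies below a quadratic in [|S|],
    whose exponential moment costs [(1 + t / q)^(q^2 / 2) <= expR (t * q / 2)]. The terms
    [t * q / 2] cancel, and a bound free of the dimension remains. *)
Lemma integral_expR_norm_le (I : eqType) (r : seq I) (S : I -> Om -> R) (t : R) :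
  uniq r -> (0 < size r)%N -> 0 < t ->
  (forall j, measurable_fun setT (S j)) ->
  (forall v : I -> R, (\int[P]_w (expR (\sum_(j <- r) v j * S j w))%:E
     <= (expR ((\sum_(j <- r) v j ^+ 2) / 2))%:E)%E) ->
  (\int[P]_w (expR (t * (Num.sqrt (\sum_(j <- r) S j w ^+ 2)
                         - Num.sqrt (size r)%:R)))%:E
     <= (expR (t ^+ 2 / 2))%:E)%E.
Proof.
move=> ur r0 t0 mS H.
set q : R := Num.sqrt (size r)%:R.
have q0 : 0 < q by rewrite sqrtr_gt0 ltr0n.
have qt0 : 0 < q + t by rewrite addr_gt0.
have q2 : q ^+ 2 = (size r)%:R by rewrite sqr_sqrtr.
(* this choice of [c] makes the AM-GM step below sharp at norm [q + t] *)
pose c : R := t / (q + t).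
have c0 : 0 <= c by rewrite divr_ge0// ltW.
have c1E : 1 - c = (1 + t / q)^-1.
  by rewrite /c; field; rewrite !gt_eqF//= addr_gt0.
have c1 : c < 1 by rewrite -subr_gt0 c1E invr_gt0 addr_gt0// divr_gt0.
have mx : measurable_fun setT (fun w => \sum_(j <- r) S j w ^+ 2).
  by apply: measurable_sum => j; exact: measurable_funX.
have := @integral_expR_sum_sqr_le R _ _ P I r S (cst 1) 1 c ur.
move=> /(_ (measurable_cst _) (fun=> ler01) mS ler01).
rewrite c0 c1 mul1r => /(_ isT) Hc0.
have Hc : (\int[P]_w (expR (c * (\sum_(j <- r) S j w ^+ 2) / 2))%:E
    <= ((Num.sqrt (1 - c))^-1 ^+ size r)%:E)%E.
  apply: le_trans (Hc0 _).
    by under [leRHS]eq_integral do rewrite mul1r.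
  by move=> v; under eq_integral do rewrite mul1r; rewrite mul1r.
have pw w : expR (t * (Num.sqrt (\sum_(j <- r) S j w ^+ 2) - q))
    <= expR (t ^+ 2 / 2 - t * q / 2)
       * expR (c * (\sum_(j <- r) S j w ^+ 2) / 2).
  rewrite -expRD ler_expR.
  have x0 : 0 <= \sum_(j <- r) S j w ^+ 2 by apply: sumr_ge0 => j _; exact: sqr_ge0.
  rewrite -[X in c * X](sqr_sqrtr x0); set x := Num.sqrt _.
  rewrite -subr_ge0.
  rewrite (_ : _ - _ = t / (2 * (q + t)) * (x - (q + t)) ^+ 2); last first.
    by rewrite /c; field; rewrite gt_eqF.
  by rewrite mulr_ge0 ?sqr_ge0// divr_ge0 ?mulr_ge0 ?ltW.
apply: (@le_trans _ _ (\int[P]_w (expR (t ^+ 2 / 2 - t * q / 2)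
       * expR (c * (\sum_(j <- r) S j w ^+ 2) / 2))%:E)%E).
  apply: ge0_le_integral => //.
  - apply/measurable_EFinP; apply: measurableT_comp => //.
    apply: measurable_funM => //; apply: measurable_funB => //.
    exact: measurable_fun_sqrtr.
  - apply/measurable_EFinP; apply: measurable_funM => //.
    apply: measurableT_comp => //; apply: measurable_funM => //.
    exact: measurable_funM.
  - by move=> w _; rewrite lee_fin.
rewrite ge0_integralZl_real ?expR_ge0//; last first.
  apply: measurableT_comp => //; apply: measurable_funM => //.
  exact: measurable_funM.
apply: (@le_trans _ _ ((expR (t ^+ 2 / 2 - t * q / 2))%:E * (expR (t * q / 2))%:E)%E); last first.
  by rewrite -EFinM -expRD subrK.
rewrite lee_wpmul2l ?lee_fin ?expR_ge0//; apply: (le_trans Hc); rewrite lee_fin.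
(* Written as a power with exponent [size r = q ^+ 2], the comparison reduces to one factor, that is
   to [1 + t / q <= expR (t / q)]. *)
have -> : expR (t * q / 2) = (expR (t / q / 2)) ^+ size r.
  rewrite -expRM_natr; congr expR; rewrite -q2; field.
  by rewrite gt_eqF.
rewrite lerXn2r ?nnegrE ?invr_ge0 ?expR_ge0//.
have tq0 : 0 <= 1 + t / q by rewrite addr_ge0// divr_ge0// ltW.
rewrite c1E sqrtrV// invrK.
rewrite -ler_sqr ?nnegrE ?expR_ge0// sqr_sqrtr//.
by rewrite -expRM_natr divfK ?pnatr_eq0// expR_ge1Dx.
Qed.

(** The Gaussian average with [c = 1 / 2] and [K = 2] gives [2 * sqrt 2], which is at most 3. *)
Lemma integral_expR_sqr_le3 (U : Om -> R) :
  measurable_fun setT U -> (forall w, 0 <= U w) ->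
  (forall t : R, 0 < t ->
    (\int[P]_w (expR (t * U w))%:E <= (2 * expR (t ^+ 2 / 2))%:E)%E) ->
  (\int[P]_w (expR (U w ^+ 2 / 4))%:E <= 3%:E)%E.
Proof.
move=> mU U0 H.
have h2 : 0 <= (2^-1 : R) < 1 by apply/andP; split; lra.
have := @integral_expR_sqr_le R _ _ P (cst 1) U 2 2^-1 (measurable_cst _)
  (fun=> ler01) mU (ler0n _ _) h2.
move=> Hq; apply: le_trans (le_trans (Hq _) _).
- rewrite le_eqVlt; apply/orP; left; apply/eqP; apply: eq_integral => w _.
  by rewrite mul1r; congr (expR _)%:E; field.
- move=> x; under eq_integral do rewrite mul1r.
  (* The average also runs over negative [x], where [U >= 0] makes the exponential at most 1. *)
  have [x0|x0] := ltP 0 x; first exact: H.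
  apply: (@le_trans _ _ (\int[P]_w (cst 1%:E w))%E).
    apply: ge0_le_integral => //.
    + apply/measurable_EFinP; apply: measurableT_comp => //.
      exact: measurable_funM.
    + by move=> w _; rewrite lee_fin -expR0 ler_expR mulr_le0_ge0.
  rewrite integral_cst// mul1e [leLHS]probability_setT lee_fin.
  apply: (@le_trans _ _ (2 * expR 0)); first by rewrite expR0; lra.
  by rewrite ler_wpM2l// ler_expR divr_ge0 ?sqr_ge0.
rewrite lee_fin (_ : 1 - 2^-1 = 2^-1 :> R); last by lra.
rewrite sqrtrV// invrK.
have s0 : 0 <= Num.sqrt (2 : R) by exact: sqrtr_ge0.
have s2 : Num.sqrt (2 : R) ^+ 2 = 2 by rewrite sqr_sqrtr.
by nra.
Qed.

(** The event depends only on the total [T] of the exponentials over all indices, and so serves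
    every [A] at the same time. It is used with coordinates and with groups as indices. *)
Lemma exists_event_sum_sqr_le (N : nat) (U : 'I_N -> Om -> R) (delta : R) :
  (0 < N)%N -> 0 < delta < 1 ->
  (forall i, measurable_fun setT (U i)) -> (forall i w, 0 <= U i w) ->
  (forall i (t : R), 0 < t ->
    (\int[P]_w (expR (t * U i w))%:E <= (2 * expR (t ^+ 2 / 2))%:E)%E) ->
  exists E : set Om, [/\ measurable E, ((1 - delta / 2)%:E <= P E)%E &
    forall w, E w -> forall A : {set 'I_N}, (0 < #|A|)%N ->
      \sum_(i in A) U i w ^+ 2
        <= #|A|%:R * (12 * Num.sqrt (ln (2 / delta)) * lamseq N #|A|) ^+ 2].
Proof.
move=> N0 /andP[d0 d1] mU U0 H.
have N0' : 0 < N%:R :> R by rewrite ltr0n.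
pose T w := \sum_(i < N) expR (U i w ^+ 2 / 4).
have mU2 i : measurable_fun setT (fun w => expR (U i w ^+ 2 / 4)).
  apply: measurableT_comp => //; apply: measurable_funM => //.
  exact: measurable_funX.
have mT : measurable_fun setT T by apply: measurable_sum.
have T0 w : 0 <= T w by apply: sumr_ge0 => i _; exact: expR_ge0.
(* Twice the mean bound [3 * N] over [delta]: Markov's inequality then gives probability at most
   [delta / 2]. *)
pose a : R := 6 * N%:R / delta.
have a0 : 0 < a by rewrite divr_gt0// mulr_gt0.
have ET : (\int[P]_w (T w)%:E <= (3 * N%:R)%:E)%E.
  under eq_integral do rewrite -sumEFin.
  rewrite ge0_integral_sum//; last by move=> i; exact/measurable_EFinP.
  apply: (@le_trans _ _ (\sum_(i < N) 3%:E)%E).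
    by apply: lee_sum => i _; apply: integral_expR_sqr_le3 => //; exact: H.
  by rewrite sumEFin lee_fin sumr_const card_ord mulr_natr.
pose F := [set w | a < T w].
have mF : measurable F by exact: measurable_set_lt.
have PF : (P F <= (delta / 2)%:E)%E.
  have : (a%:E * P F <= (3 * N%:R)%:E)%E.
    apply: le_trans ET.
    rewrite -[X in (_ * P X)%E]setIT -integral_indic// -ge0_integralZl_real//; last first.
      exact: ltW.
    apply: ge0_le_integral => //.
    - by move=> w _; rewrite lee_fin mulr_ge0// ltW.
    - by apply/measurable_EFinP; apply: measurable_funM.
    - exact/measurable_EFinP.
    - move=> w _; rewrite lee_fin indicE.
      case: (boolP (w \in F)); last by rewrite mulr0.
      by rewrite inE mulr1 => /ltW.
  rewrite -(@fineK _ (P F)) ?fin_num_measure// -EFinM !lee_fin.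
  rewrite -ler_pdivlMl// => /le_trans; apply; rewrite le_eqVlt; apply/orP; left.
  by apply/eqP; rewrite /a; field; rewrite !gt_eqF.
exists (~` F); split.
- exact: measurableC.
- by rewrite probability_setC// EFinB leeB.
move=> w; rewrite /F/= => /negP; rewrite -leNgt => Tw A A0.
have m0 : 0 < #|A|%:R :> R by rewrite ltr0n.
have AN : (#|A| <= N)%N by rewrite -[X in (_ <= X)%N]card_ord max_card.
have mN : #|A|%:R <= N%:R :> R by rewrite ler_nat.
pose y := ln (a / #|A|%:R).
have ey : expR y = a / #|A|%:R by rewrite lnK// posrE divr_gt0.
(* Jensen's inequality for [expR], through its tangent at [y] *)
have J : \sum_(i in A) U i w ^+ 2 / 4 <= #|A|%:R * y.
  have : \sum_(i in A) (1 + (U i w ^+ 2 / 4 - y)) <= \sum_(i in A) 1.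
    rewrite -(@ler_pM2l _ (expR y)) ?expR_gt0//.
    apply: (@le_trans _ _ (\sum_(i in A) expR (U i w ^+ 2 / 4))).
      rewrite mulr_sumr; apply: ler_sum => i _.
      rewrite -[X in _ <= expR X](subrK y) [X in _ <= expR X]addrC expRD.
      by rewrite ler_wpM2l ?expR_ge0// expR_ge1Dx.
    apply: (@le_trans _ _ (T w)).
      rewrite /T [leRHS](bigID (mem A))/= lerDl.
      by apply: sumr_ge0 => i _; exact: expR_ge0.
    by rewrite sumr_const ey divfK ?gt_eqF.
  by rewrite big_split/= gerDl sumrB subr_le0 sumr_const mulr_natl.
(* As [6 <= 4 * expR 1], [y] is at most [p + q]; from [p >= 1 / 2] and [q >= 1] one gets
   [p + q <= 3 * p * q], well within the [144 * p * q] of the right-hand side. *)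
have AB : 4 * y <= (12 * Num.sqrt (ln (2 / delta)) * lamseq N #|A|) ^+ 2.
  have d2 : 2 <= 2 / delta by rewrite ler_pdivlMr//; lra.
  set p := ln (2 / delta); pose q : R := ln (2 * N%:R * expR 1 / #|A|%:R).
  have ln2 : 2^-1 <= ln 2 :> R.
    have : ln (1 + - 2^-1) <= - 2^-1 :> R by apply: le_ln1Dx; lra.
    by rewrite (_ : 1 + - 2^-1 = 2^-1 :> R) ?lnV ?posrE//; lra.
  have p2 : 2^-1 <= p by apply: le_trans ln2 _; rewrite ler_ln// posrE; lra.
  have e2 : 2 <= expR 1 :> R by have := @expR_ge1Dx R 1; lra.
  have q1 : 1 <= q.
    rewrite -[leLHS]expRK /q ler_ln ?posrE ?expR_gt0//; last first.
      by rewrite divr_gt0// !mulr_gt0// expR_gt0.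
    rewrite ler_pdivlMr// mulrC ler_wpM2r ?expR_ge0//; nra.
  have yE : y <= p + q.
    rewrite /p /q -lnM ?posrE ?divr_gt0 ?mulr_gt0 ?expR_gt0//.
    rewrite ler_ln ?posrE ?mulr_gt0 ?invr_gt0 ?expR_gt0//.
    rewrite (_ : 2 / delta * _ = (2 * (2 * expR 1)) * N%:R / delta / #|A|%:R); last first.
      by field; rewrite !gt_eqF.
    apply: ler_wpM2r; first by rewrite invr_ge0 ltW.
    apply: ler_wpM2r; first by rewrite invr_ge0 ltW.
    by apply: ler_wpM2r; [rewrite ltW|lra].
  rewrite /lamseq -/q !exprMn !sqr_sqrtr; nra.
rewrite -mulr_suml ler_pdivrMr// in J; apply: (le_trans J).
rewrite (_ : #|A|%:R * y * 4 = #|A|%:R * (4 * y)); last by ring.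
by apply: ler_wpM2l => //; exact: ltW.
Qed.

End Concentration.

(** * Rearrangements *)

Section Rearrangement.
Variable R : realType.

Lemma le_sqrtr_of_sqr (x y : R) : x ^+ 2 <= y -> x <= Num.sqrt y.
Proof.
move=> xy; apply: le_trans (ler_norm x) _.
by rewrite -sqrtr_sqr ler_wsqrtr.
Qed.

Lemma cauchy_schwarz_sum (I : Type) (r : seq I) (Q : pred I) (x y : I -> R) :
  \sum_(i <- r | Q i) x i * y i <=
    Num.sqrt (\sum_(i <- r | Q i) x i ^+ 2) * Num.sqrt (\sum_(i <- r | Q i) y i ^+ 2).
Proof.
elim: r => [|i r IH]; first by rewrite !big_nil sqrtr0 mul0r.
rewrite !big_cons; case: (Q i) => //.
have X0 : 0 <= \sum_(i <- r | Q i) x i ^+ 2 by apply: sumr_ge0 => j _; exact: sqr_ge0.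
have Y0 : 0 <= \sum_(i <- r | Q i) y i ^+ 2 by apply: sumr_ge0 => j _; exact: sqr_ge0.
rewrite -(sqr_sqrtr X0) -(sqr_sqrtr Y0).
move: IH; set a := Num.sqrt (\sum_(i <- r | Q i) x i ^+ 2); set b := Num.sqrt (\sum_(i <- r | Q i) y i ^+ 2) => IH.
rewrite -sqrtrM ?addr_ge0 ?sqr_ge0//.
apply: (@le_trans _ _ (x i * y i + a * b)); first by rewrite lerD2l.
apply: le_sqrtr_of_sqr; rewrite -subr_ge0.
rewrite (_ : _ - _ = (x i * b - a * y i) ^+ 2); first exact: sqr_ge0.
by ring.
Qed.

(** Equal cardinalities allow [f] to be shifted by its minimum over [B]. The shifted terms are then
    nonnegative on [B] and nonpositive off [B], and those common to [A] and [B] cancel. *)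
Lemma sum_le_top (I : finType) (f : I -> R) (A B : {set I}) :
  #|A| = #|B| -> (forall i j, i \in B -> j \notin B -> f j <= f i) ->
  \sum_(i in A) f i <= \sum_(i in B) f i.
Proof.
move=> AB Btop.
have [B0|[b bB]] := set_0Vmem B.
  by move: AB; rewrite B0 cards0 => /eqP; rewrite cards_eq0 => /eqP ->.
have [t tB tmin] := @arg_minP _ R I b (mem B) f bB.
rewrite -subr_le0 -(@ler_nM2l _ (-1)) ?ltrN10// mulr0 mulN1r opprB.
have -> : \sum_(i in B) f i - \sum_(i in A) f i =
  \sum_(i in B) (f i - f t) - \sum_(i in A) (f i - f t).
  by rewrite !sumrB !sumr_const AB; ring.
rewrite subr_ge0 [leLHS](bigID (mem B)) [leRHS](bigID (mem A))/=.
rewrite [X in X + _ <= _](eq_bigl (fun i => (i \in B) && (i \in A))); last first.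
  by move=> i; rewrite andbC.
apply: lerD => //; apply: (@le_trans _ _ 0).
  by apply: sumr_le0 => i /andP[_ iB]; rewrite subr_le0 Btop.
by apply: sumr_ge0 => i /andP[iB _]; rewrite subr_ge0 tmin.
Qed.

(** The invariant [c m * D m.+1 <= ...], with [D] the partial sums of [v - u], replaces summation by
    parts: since [D] is nonnegative, lowering the weight from [c m] to [c m.+1] preserves it. *)
Lemma abel_sum_le (N : nat) (c u v : nat -> R) :
  (forall i j, (i <= j < N)%N -> c j <= c i) ->
  (forall i, (i < N)%N -> 0 <= c i) ->
  (forall m, (m <= N)%N -> \sum_(0 <= i < m) u i <= \sum_(0 <= i < m) v i) ->
  \sum_(0 <= i < N) c i * u i <= \sum_(0 <= i < N) c i * v i.
Proof.
move=> cdec c0 uv.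
pose D m := \sum_(0 <= i < m) (v i - u i).
have D0 m : (m <= N)%N -> 0 <= D m by move=> mN; rewrite /D sumrB subr_ge0 uv.
have H m : (m < N)%N -> c m * D m.+1 <= \sum_(0 <= i < m.+1) c i * (v i - u i).
  elim: m => [|m IH] mN; first by rewrite /D !big_nat1.
  rewrite big_nat_recr//= /D [X in _ * X]big_nat_recr//= -/(D m.+1) mulrDr lerD2r.
  apply: le_trans (IH (ltnW mN)); apply: ler_wpM2r; first by apply: D0; exact: ltnW.
  by apply: cdec; rewrite leqnSn.
rewrite -subr_ge0 -sumrB.
under eq_bigr do rewrite -mulrBr.
case: N cdec c0 uv D0 H => [|N] cdec c0 uv D0 H; first by rewrite big_geq.
by apply: le_trans (H N (ltnSn N)); rewrite mulr_ge0 ?c0 ?D0.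
Qed.

Lemma sum_take_nth (s : seq R) (m : nat) (F : R -> R) : (m <= size s)%N ->
  \sum_(0 <= i < m) F (nth 0 s i) = \sum_(x <- take m s) F x.
Proof.
move=> ms; rewrite [RHS](big_nth (0 : R)) size_takel//.
by apply: eq_big_nat => i /andP[_ im]; rewrite nth_take.
Qed.

Variable N : nat.
Implicit Types (a h : 'I_N -> R) (A B : {set 'I_N}).

(** At the absolute values of [z] this is [sorted_abs z] by conversion, which links the
    rearrangement lemmas to the Slope norm. *)
Definition decr (h : 'I_N -> R) : seq R :=
  sort (fun a b : R => b <= a) [seq h j | j <- enum 'I_N].

(** Indices are sorted rather than values, so that ties are broken and the first [m] of them form a
    set of exactly [m] indices. *)
Definition decr_idx (h : 'I_N -> R) : seq 'I_N :=
  sort (relpre h (fun a b : R => b <= a)) (enum 'I_N).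

Definition top_idx (h : 'I_N -> R) (m : nat) : {set 'I_N} :=
  [set j in take m (decr_idx h)].

Lemma decrE h : decr h = [seq h j | j <- decr_idx h].
Proof. by rewrite /decr sort_map. Qed.

Lemma size_decr_idx h : size (decr_idx h) = N.
Proof. by rewrite size_sort size_enum_ord. Qed.

Lemma size_decr h : size (decr h) = N.
Proof. by rewrite decrE size_map size_decr_idx. Qed.

Lemma uniq_decr_idx h : uniq (decr_idx h).
Proof. by rewrite sort_uniq enum_uniq. Qed.

Lemma mem_decr_idx h j : j \in decr_idx h.
Proof. by rewrite mem_sort mem_enum. Qed.

Lemma decr_le h i j : (i <= j < N)%N -> nth 0 (decr h) j <= nth 0 (decr h) i.
Proof.
move=> /andP[ij jN].
have tr : transitive (fun a b : R => b <= a) by move=> x y z /[swap]; exact: le_trans.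
apply: (sorted_leq_nth tr _ 0 _) => //.
- by apply: sort_sorted => x y /=; exact: le_total.
- by rewrite inE size_decr (leq_ltn_trans ij).
- by rewrite inE size_decr.
Qed.

Lemma decr_ge0 h i : (forall j, 0 <= h j) -> 0 <= nth 0 (decr h) i.
Proof.
move=> h0; have [iN|iN] := ltnP i N; last by rewrite nth_default// size_decr.
have : nth 0 (decr h) i \in decr h by rewrite mem_nth// size_decr.
by rewrite decrE => /mapP[j _ ->].
Qed.

Lemma card_top_idx h m : (m <= N)%N -> #|top_idx h m| = m.
Proof.
move=> mN; rewrite cardsE; have /card_uniqP -> := take_uniq m (uniq_decr_idx h).
by rewrite size_takel// size_decr_idx.
Qed.

Lemma sum_top_idx h a m : (m <= N)%N ->
  \sum_(j in top_idx h m) a j =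
  \sum_(0 <= i < m) nth 0 [seq a j | j <- decr_idx h] i.
Proof.
move=> mN; rewrite (sum_take_nth _ m id); last by rewrite size_map size_decr_idx.
rewrite -map_take big_map big_uniq ?take_uniq ?uniq_decr_idx//=.
by apply: eq_bigl => j; rewrite inE.
Qed.

Lemma sum_top_idx_comp h (F : R -> R) m : (m <= N)%N ->
  \sum_(j in top_idx h m) F (h j) = \sum_(0 <= i < m) F (nth 0 (decr h) i).
Proof.
move=> mN; rewrite sum_top_idx//; apply: eq_big_nat => i /andP[_ im].
have iN : (i < N)%N by exact: leq_trans mN.
by rewrite decrE (map_comp F h) (nth_map 0)// size_map size_decr_idx.
Qed.

Lemma top_idx_ge h m i j : i \in top_idx h m -> j \notin top_idx h m -> h j <= h i.
Proof.
rewrite !inE => im jm.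
have jt := mem_decr_idx h j; have it : i \in decr_idx h by exact: mem_take im.
have e k : k \in decr_idx h -> h k = nth 0 (decr h) (index k (decr_idx h)).
  by move=> kt; rewrite decrE (nth_map i) ?index_mem// nth_index.
rewrite (e i)// (e j)//; apply: decr_le; apply/andP; split; last first.
  by have := jt; rewrite -index_mem size_decr_idx.
apply: (@leq_trans m); last first.
  by rewrite leqNgt; apply: contra jm => jm'; rewrite in_take.
by apply: ltnW; rewrite -in_take.
Qed.

Lemma sum_top_idx_all h a : \sum_(j in top_idx h N) a j = \sum_j a j.
Proof.
apply: eq_bigl => j; rewrite inE take_oversize ?size_decr_idx//.
by rewrite mem_decr_idx.
Qed.

Lemma sum_le_decr h A : \sum_(j in A) h j <= \sum_(0 <= i < #|A|) nth 0 (decr h) i.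
Proof.
have AN : (#|A| <= N)%N by rewrite -[X in (_ <= X)%N]card_ord max_card.
rewrite -(sum_top_idx_comp h id _ AN).
apply: sum_le_top; first by rewrite card_top_idx.
by move=> i j; exact: top_idx_ge.
Qed.

(** Listed by decreasing [h], the products have [h] as nonincreasing weights, and the partial sums
    of [a] are sums over sets [top_idx h m], to which the hypothesis applies; Abel summation
    concludes. *)
Lemma sum_mul_le_decr a h (v : nat -> R) : (forall j, 0 <= h j) ->
  (forall A, \sum_(j in A) a j <= \sum_(0 <= i < #|A|) v i) ->
  \sum_j a j * h j <= \sum_(0 <= i < N) v i * nth 0 (decr h) i.
Proof.
move=> h0 av; rewrite -(sum_top_idx_all h) sum_top_idx//.
under [leRHS]eq_bigr do rewrite mulrC.
apply: (@le_trans _ _ (\sum_(0 <= i < N)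
    nth 0 (decr h) i * nth 0 [seq a j | j <- decr_idx h] i)).
  rewrite le_eqVlt; apply/orP; left; apply/eqP; apply: eq_big_nat => i /andP[_ iN].
  by rewrite decrE !(nth_map (Ordinal iN)) ?size_decr_idx// mulrC.
apply: abel_sum_le.
- by move=> i j; exact: decr_le.
- by move=> i _; exact: decr_ge0.
- by move=> m mN; rewrite -sum_top_idx// -[in leRHS](card_top_idx h _ mN).
Qed.

(* The sum of [a * h] is largest when both are sorted alike; Cauchy-Schwarz is
   used on the [k] largest terms, and [B] bounds the remaining [a]'s. *)
Lemma sum_mul_le_top a h (k : nat) (B : R) (J : {set 'I_N}) :
  (0 < k)%N -> 0 <= B -> (forall j, 0 <= a j) -> (forall j, 0 <= h j) ->
  #|J| = k -> (forall i j, i \in J -> j \notin J -> h j <= h i) ->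
  (forall A, #|A| = k -> \sum_(j in A) a j ^+ 2 <= k%:R * B ^+ 2) ->
  \sum_j a j * h j <= B * (Num.sqrt k%:R * Num.sqrt (\sum_(j in J) h j ^+ 2)
                           + \sum_(j in ~: J) h j).
Proof.
move=> k0 B0 a0 h0 Jk Jtop HA.
have kN : (k <= N)%N by rewrite -Jk -[X in (_ <= X)%N]card_ord max_card.
have k0' : 0 < k%:R :> R by rewrite ltr0n.
pose qa := nth 0 (decr a); pose qh := nth 0 (decr h).
apply: (@le_trans _ _ (\sum_(0 <= i < N) qa i * qh i)).
  by apply: sum_mul_le_decr => // A; exact: sum_le_decr.
have qa2 : \sum_(0 <= i < k) qa i ^+ 2 <= k%:R * B ^+ 2.
  rewrite -(sum_top_idx_comp a (fun x => x ^+ 2))//.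
  by apply: HA; rewrite card_top_idx.
(* An entry of rank beyond [k] is at most each of the [k] largest, so [k] copies of its square fit
   under [k * B ^+ 2]. *)
have qaB i : (k <= i < N)%N -> qa i <= B.
  move=> /andP[ki iN].
  have : k%:R * qa i ^+ 2 <= k%:R * B ^+ 2.
    apply: le_trans qa2; rewrite mulr_natl -[X in _ *+ X]subn0 -sumr_const_nat.
    apply: ler_sum_nat => l /andP[_ lk].
    rewrite lerXn2r ?nnegrE ?decr_ge0// decr_le// iN andbT.
    by apply: ltnW; exact: leq_trans ki.
  by rewrite ler_pM2l// ler_sqr ?nnegrE ?decr_ge0.
have hJ : \sum_(0 <= i < k) qh i ^+ 2 <= \sum_(j in J) h j ^+ 2.
  rewrite -(sum_top_idx_comp h (fun x => x ^+ 2))//.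
  apply: sum_le_top; first by rewrite card_top_idx.
  by move=> i j iJ jJ; rewrite lerXn2r ?nnegrE ?Jtop.
(* Both splittings have the same total, and the sum over [J] is at most that of the [k] largest
   entries, so the sorted tail is at most the sum off [J]. *)
have hJc : \sum_(k <= i < N) qh i <= \sum_(j in ~: J) h j.
  have hall : \sum_(j in J) h j + \sum_(j in ~: J) h j =
    \sum_(0 <= i < k) qh i + \sum_(k <= i < N) qh i.
    rewrite -big_cat_nat//= -(sum_top_idx_comp h id)// sum_top_idx_all.
    by rewrite [RHS](bigID (mem J))/=; congr (_ + _); apply: eq_bigl => j; rewrite inE.
  have := sum_le_decr h J; rewrite Jk -/qh; lra.
rewrite (big_cat_nat (n := k))//= mulrDr; apply: lerD; last first.
  apply: (@le_trans _ _ (\sum_(k <= i < N) B * qh i)).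
    apply: ler_sum_nat => i iN; apply: ler_wpM2r; first exact: decr_ge0.
    exact: qaB.
  by rewrite -mulr_sumr ler_wpM2l.
apply: le_trans (cauchy_schwarz_sum _ _ _ _ _) _.
rewrite mulrA; apply: ler_pM => //; last by rewrite ler_wsqrtr.
apply: (@le_trans _ _ (Num.sqrt (k%:R * B ^+ 2))); first by rewrite ler_wsqrtr.
by rewrite sqrtrM ?ler0n// sqrtr_sqr ger0_norm// mulrC.
Qed.

End Rearrangement.

(** * Sorted norms and cones *)

Section Cones.
Variable R : realType.

Lemma exists_subset_card (T : finType) (D : {set T}) (n : nat) :
  (n <= #|D|)%N -> exists2 Q : {set T}, Q \subset D & #|Q| = n.
Proof.
move=> nD; exists [set x in take n (enum D)]%SET.
  by apply/fintype.subsetP => x; rewrite inE => /mem_take; rewrite mem_enum.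
rewrite cardsE; have /card_uniqP -> := take_uniq n (enum_uniq (mem D)).
by rewrite size_takel// -cardE.
Qed.

Lemma norm0E (p : nat) (b : 'I_p -> R) : norm0 b = #|[set j | b j != 0]%SET|.
Proof. by rewrite /norm0; apply: eq_card => j; apply/idP/idP; rewrite !inE. Qed.

Lemma gsizeE (p G : nat) (grp : 'I_p -> 'I_G) (g : 'I_G) :
  gsize grp g = #|[set j | grp j == g]%SET|.
Proof. by rewrite /gsize; apply: eq_card => j; apply/idP/idP; rewrite !inE. Qed.

Lemma lamseq_gt0 (N m : nat) : (0 < m <= N)%N -> 0 < lamseq N m :> R.
Proof.
move=> /andP[m0 mN]; rewrite sqrtr_gt0 ln_gt0// ltr_pdivlMr ?ltr0n// mul1r.
have m0' : 0 < m%:R :> R by rewrite ltr0n.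
have mN' : m%:R <= N%:R :> R by rewrite ler_nat.
have e2 : 2 <= expR 1 :> R by have := @expR_ge1Dx R 1; lra.
by nra.
Qed.

Lemma lamseq_le (N i j : nat) : (0 < N)%N -> (0 < i <= j)%N ->
  lamseq N j <= lamseq N i :> R.
Proof.
move=> N0 /andP[i0 ij].
have j0 : (0 < j)%N by exact: leq_trans ij.
have a0 : 0 < 2 * N%:R * expR 1 :> R by rewrite !mulr_gt0 ?ltr0n ?expR_gt0.
rewrite ler_wsqrtr// ler_ln ?posrE ?divr_gt0 ?ltr0n//.
by rewrite ler_wpM2l ?(ltW a0)// lef_pV2 ?posrE ?ltr0n// ler_nat.
Qed.

(* By Abel summation it suffices to compare, for each [m], the sums of the [m]
   largest entries. *)
Lemma weighted_decr_diff_le (p : nat) (c : nat -> R) (b b' : 'I_p -> R) :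
  let q (z : 'I_p -> R) i := nth 0 (decr _ p (fun j => `|z j|)) i in
  let h := fun j => b' j - b j in
  (forall i j, (i <= j < p)%N -> c j <= c i) ->
  (forall i, (i < p)%N -> 0 <= c i) ->
  \sum_(0 <= i < p) c i * q b i - \sum_(0 <= i < p) c i * q b' i <=
  \sum_(0 <= i < norm0 b) c i * q h i - \sum_(norm0 b <= i < p) c i * q h i.
Proof.
move=> q h cdec c0.
pose D := [set j | b j != 0]%SET; have kE : norm0 b = #|D| by exact: norm0E.
move: kE; set k := norm0 b => kE.
have kp : (k <= p)%N by rewrite kE -[X in (_ <= X)%N]card_ord max_card.
have tri j : `|b j| <= `|b' j| + `|h j|.
  by rewrite -[b j](subKr (b' j)); apply: le_trans (ler_normB _ _) _.
(* The sign change at [k] makes the right-hand side a single weighted sum, as Abel summation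
   requires. *)
pose v i := if (i < k)%N then q h i else - q h i.
have vlt m : (m <= k)%N -> \sum_(0 <= i < m) v i = \sum_(0 <= i < m) q h i.
  by move=> mk; apply: eq_big_nat => i /andP[_ im]; rewrite /v (leq_trans im).
have -> : \sum_(0 <= i < k) c i * q h i - \sum_(k <= i < p) c i * q h i =
  \sum_(0 <= i < p) c i * v i.
  rewrite [RHS](big_cat_nat (n := k))//= -sumrN; congr (_ + _); apply: eq_big_nat => i.
    by move=> /andP[_ ik]; rewrite /v ik.
  by move=> /andP[ki _]; rewrite /v ltnNge ki mulrN.
rewrite -sumrB; under eq_bigr do rewrite -mulrBr.
apply: abel_sum_le => // m mp; rewrite sumrB lerBlDr.
have [mk|km] := leqP m k.
  rewrite vlt// -(sum_top_idx_comp _ _ (fun j => `|b j|) id)//.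
  set A := top_idx _ _ _ _; have Am : #|A| = m by rewrite card_top_idx.
  apply: (@le_trans _ _ (\sum_(j in A) (`|h j| + `|b' j|))).
    by apply: ler_sum => j _; rewrite addrC.
  rewrite big_split/=; apply: lerD.
    by have := sum_le_decr _ _ (fun j => `|h j|) A; rewrite Am.
  by have := sum_le_decr _ _ (fun j => `|b' j|) A; rewrite Am.
have -> : \sum_(0 <= i < m) v i
    = \sum_(0 <= i < k) q h i - \sum_(k <= i < m) q h i.
  rewrite (big_cat_nat (n := k)) ?(ltnW km)//= vlt//; congr (_ + _).
  rewrite -sumrN; apply: eq_big_nat => i /andP[ki _].
  by rewrite /v ltnNge ki.
pose T := top_idx R p (fun j => `|h j|) m.
have Tm : #|T| = m by rewrite card_top_idx.
(* For [m > k], the support [D] is completed to [m] indices by a set [Q] taken among the [m] largest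
   entries of [h]. On [Q] the vector [b] vanishes, so [b'] and [h] agree there. *)
have [Q QT Qc] : exists2 Q : {set 'I_p}, Q \subset T :\: D & #|Q| = (m - k)%N.
  apply: exists_subset_card; rewrite cardsD Tm kE leq_sub2l//.
  by rewrite subset_leq_card// finset.subsetIr.
have QD : fintype.disjoint (mem Q) (mem D).
  by rewrite disjoint_subset; apply/fintype.subsetP => x /(fintype.subsetP QT); rewrite !inE => /andP[].
have QT' : Q \subset T by apply: fintype.subset_trans QT _; exact: finset.subsetDl.
have hQ : \sum_(k <= i < m) q h i <= \sum_(j in Q) `|h j|.
  have : \sum_(j in T) `|h j| = \sum_(0 <= i < m) q h i.
    by rewrite (sum_top_idx_comp _ _ (fun j => `|h j|) id).
  rewrite (big_cat_nat (n := k)) ?(ltnW km)//= (big_setID Q)/= (finset.setIidPr QT').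
  have := sum_le_decr _ _ (fun j => `|h j|) (T :\: Q).
  rewrite cardsD (finset.setIidPr QT') Tm Qc subKn ?(ltnW km)// -/(q h); lra.
have hD : \sum_(j in D) `|h j| <= \sum_(0 <= i < k) q h i.
  by have := sum_le_decr _ _ (fun j => `|h j|) D; rewrite -kE.
have b'Q : \sum_(j in D) `|b' j| + \sum_(j in Q) `|h j| <= \sum_(0 <= i < m) q b' i.
  have := sum_le_decr _ _ (fun j => `|b' j|) (D :|: Q).
  rewrite cardsU (_ : D :&: Q = finset.set0); last first.
    by apply/eqP; rewrite finset.setI_eq0 disjoint_sym.
  rewrite cards0 subn0 -kE Qc subnKC ?(ltnW km)//; apply: le_trans.
  rewrite [leRHS](eq_bigl [predU D & Q]); last by move=> j; rewrite finset.in_setU.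
  rewrite bigU/= ?lerD2l; last by rewrite disjoint_sym.
  apply: ler_sum => j jQ; rewrite /h.
  have : j \notin D by rewrite (disjointFr QD).
  by rewrite inE negbK => /eqP ->; rewrite subr0.
have bD : \sum_(0 <= i < m) q b i <= \sum_(j in D) `|b j|.
  rewrite -(sum_top_idx_comp _ _ (fun j => `|b j|) id)//.
  rewrite [leRHS](_ : _ = \sum_j `|b j|); last first.
    rewrite [RHS](bigID (mem D))/= [X in _ = _ + X]big1 ?addr0// => j.
    by rewrite inE negbK => /eqP ->; rewrite normr0.
  rewrite [leRHS](bigID (mem (top_idx R p (fun j => `|b j|) m)))/= lerDl.
  by apply: sumr_ge0.
have : \sum_(j in D) `|b j| <= \sum_(j in D) `|b' j| + \sum_(j in D) `|h j|.
  by rewrite -big_split/=; apply: ler_sum.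
lra.
Qed.

(** The penalty grows by at least the sum of [nh] off [Jst] minus that on [Jst]. Passing to [J],
    where [nh] is largest, only lowers this difference, and the upper bound on the growth is then
    solved for the sum off [J]. Entries serve for the Lasso, group norms for the group Lasso. *)
Lemma cone_of_penalty (N : nat) (J Jst : {set 'I_N}) (nb nbh nh : 'I_N -> R)
    (alpha q : R) :
  1 < alpha -> #|J| = #|Jst| ->
  (forall g g', g \in J -> g' \notin J -> nh g' <= nh g) ->
  (forall g, g \in Jst -> nb g - nh g <= nbh g) ->
  (forall g, g \notin Jst -> nb g + nh g <= nbh g) ->
  alpha * (\sum_g nbh g - \sum_g nb g) <= q + \sum_(g in ~: J) nh g ->
  \sum_(g in ~: J) nh g <=
    alpha / (alpha - 1) * \sum_(g in J) nh g + q / (alpha - 1).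
Proof.
move=> a1 JJ Jtop Hin Hout H.
have a1' : 0 < alpha - 1 by rewrite subr_gt0.
have splitE (F : 'I_N -> R) (A : {set 'I_N}) :
    \sum_g F g = \sum_(g in A) F g + \sum_(g in ~: A) F g.
  by rewrite [LHS](bigID (mem A))/=; congr (_ + _); apply: eq_bigl => g; rewrite inE.
have D1 : \sum_(g in ~: Jst) nh g - \sum_(g in Jst) nh g
    <= \sum_g nbh g - \sum_g nb g.
  rewrite (splitE nbh Jst) (splitE nb Jst).
  have : \sum_(g in Jst) (nb g - nh g) <= \sum_(g in Jst) nbh g by apply: ler_sum.
  have : \sum_(g in ~: Jst) (nb g + nh g) <= \sum_(g in ~: Jst) nbh g.
    by apply: ler_sum => g; rewrite inE; exact: Hout.
  by rewrite big_split/= sumrB; lra.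
have D2 := sum_le_top _ _ nh _ _ (esym JJ) Jtop.
have := splitE nh J; rewrite (splitE nh Jst) => D3.
have D4 : \sum_(g in ~: J) nh g - \sum_(g in J) nh g <= \sum_g nbh g - \sum_g nb g.
  by lra.
rewrite mulrAC -mulrDl ler_pdivlMr//.
have : alpha * (\sum_(g in ~: J) nh g - \sum_(g in J) nh g) <=
  alpha * (\sum_g nbh g - \sum_g nb g) by rewrite ler_pM2l//; lra.
by lra.
Qed.

End Cones.

(** * Group norms and the score *)

Section GroupNorm.
Variables (R : realType) (p G : nat) (grp : 'I_p -> 'I_G).
Implicit Types (x y z : 'I_p -> R) (g : 'I_G).

Lemma minkowski_sum (I : Type) (r : seq I) (Q : pred I) (x y : I -> R) :
  Num.sqrt (\sum_(i <- r | Q i) (x i + y i) ^+ 2) <=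
    Num.sqrt (\sum_(i <- r | Q i) x i ^+ 2) + Num.sqrt (\sum_(i <- r | Q i) y i ^+ 2).
Proof.
rewrite -ler_sqr ?nnegrE ?addr_ge0 ?sqrtr_ge0//.
have s0 (F : I -> R) : 0 <= \sum_(i <- r | Q i) F i ^+ 2.
  by apply: sumr_ge0 => i _; exact: sqr_ge0.
rewrite sqrrD !sqr_sqrtr//.
rewrite [leLHS](_ : _ = \sum_(i <- r | Q i) x i ^+ 2
  + (\sum_(i <- r | Q i) x i * y i) *+ 2 + \sum_(i <- r | Q i) y i ^+ 2); last first.
  by rewrite -sumrMnl -!big_split/=; apply: eq_bigr => i _; rewrite sqrrD.
by rewrite lerD2r lerD2l lerMn2r cauchy_schwarz_sum.
Qed.

Lemma grpnorm_ge0 z g : 0 <= grpnorm grp z g.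
Proof. exact: sqrtr_ge0. Qed.

Lemma sqr_grpnorm z g : grpnorm grp z g ^+ 2 = \sum_(j < p | grp j == g) z j ^+ 2.
Proof. by rewrite sqr_sqrtr// sumr_ge0// => j _; exact: sqr_ge0. Qed.

Lemma grpnorm_le_add x y g :
  grpnorm grp x g <= grpnorm grp y g + grpnorm grp (fun j => y j - x j) g.
Proof.
rewrite /grpnorm (eq_bigr (fun j => (y j + (x j - y j)) ^+ 2)); last first.
  by move=> j _; rewrite addrC subrK.
apply: le_trans (minkowski_sum _ _ _ _ _) _; rewrite lerD2l.
rewrite le_eqVlt; apply/orP; left; apply/eqP; congr Num.sqrt.
by apply: eq_bigr => j _; rewrite -sqrrN opprB.
Qed.

Lemma sum_sqr_grpnorm z (J : {set 'I_G}) :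
  \sum_(g in J) grpnorm grp z g ^+ 2 = \sum_(j < p | grp j \in J) z j ^+ 2.
Proof.
rewrite [RHS](partition_big grp (mem J))//=; apply: eq_bigr => g gJ.
rewrite sqr_grpnorm; apply: eq_bigl => j.
by case: eqP => [->|]; rewrite ?gJ// andbF.
Qed.

Lemma sum_mul_le_grpnorm x y :
  \sum_j x j * y j <= \sum_g grpnorm grp x g * grpnorm grp y g.
Proof.
rewrite (partition_big grp predT)//=; apply: ler_sum => g _.
exact: cauchy_schwarz_sum.
Qed.

Lemma grpnormN z g : grpnorm grp (fun j => - z j) g = grpnorm grp z g.
Proof. by congr Num.sqrt; apply: eq_bigr => j _; rewrite sqrrN. Qed.

End GroupNorm.

(** * Exponential moments of the normalised score *)

Section Score.
Variables (R : realType) (dO : measure_display) (Om : measurableType dO).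
Variables (P : probability Om R) (dZ : measure_display) (Z : measurableType dZ).
Variables (n p : nat) (W : 'I_n -> Om -> Z) (X : 'I_p -> Z -> R) (s : R).

(** A sum of [n] independent terms of variance proxy [s ^+ 2] is scaled to variance proxy 1; the
    average of the terms is [s / sqrt n] times the score. *)
Definition score (j : 'I_p) (w : Om) : R :=
  (s * Num.sqrt n%:R)^-1 * \sum_(i < n) X j (W i w).

Hypotheses (n_gt0 : (0 < n)%N) (s_gt0 : 0 < s).
Hypothesis measurable_W : forall i, measurable_fun setT (W i).
Hypothesis indep_W : mutually_indep P W.
Hypothesis measurable_X : forall j, measurable_fun setT (X j).

Lemma measurable_score j : measurable_fun setT (score j).
Proof.
apply: measurable_funM => //; apply: measurable_sum => i.
exact: measurableT_comp.
Qed.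

(** By independence the exponential moment is bounded by a product of [n] factors, each contributing
    [1 / n] of the exponent. *)
Lemma integral_expR_score_le (A : {set 'I_p}) (v : 'I_p -> R) :
  (forall i, subG_vec P A (fun w j => X j (W i w)) (s ^+ 2)) ->
  (\int[P]_w (expR (\sum_(j in A) v j * score j w))%:E
     <= (expR ((\sum_(j in A) v j ^+ 2) / 2))%:E)%E.
Proof.
move=> HA.
have n0 : 0 < n%:R :> R by rewrite ltr0n.
have sn0 : 0 < s * Num.sqrt n%:R by rewrite mulr_gt0// sqrtr_gt0.
pose c := (s * Num.sqrt n%:R)^-1.
have c0 : 0 < c by rewrite invr_gt0.
have c2 : s ^+ 2 * c ^+ 2 = n%:R^-1.
  rewrite /c exprVn exprMn sqr_sqrtr ?ltW// invfM mulrA divff ?mul1r//.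
  by rewrite sqrf_eq0 gt_eqF.
pose f (i : 'I_n) z := expR (c * \sum_(j in A) v j * X j z).
pose K (i : 'I_n) := expR (n%:R^-1 * (\sum_(j in A) v j ^+ 2) / 2).
have := @integral_prod_indep_le R _ Om P _ Z n W f K measurable_W indep_W.
have -> : \prod_(i < n) K i = expR ((\sum_(j in A) v j ^+ 2) / 2).
  rewrite prodr_const card_ord -expRM_natr; congr expR.
  by field; rewrite gt_eqF.
have E w : \prod_(i < n) f i (W i w) = expR (\sum_(j in A) v j * score j w).
  rewrite -expR_sum; congr expR; rewrite -mulr_sumr exchange_big/= mulr_sumr.
  by apply: eq_bigr => j _; rewrite /score -mulr_sumr mulrCA.
under eq_integral do rewrite E.
apply.
- move=> i; apply: measurableT_comp => //; apply: measurable_funM => //.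
  under eq_fun do rewrite -big_enum.
  by apply: measurable_sum => j; exact: measurable_funM.
- by move=> i z; exact: expR_ge0.
- by move=> i; rewrite /K -c2; exact: HA.
Qed.

(** [expR (t * |x|)] is at most [expR (t * x) + expR (- t * x)]; each sign is the vector bound at a
    vector supported on [j]. This produces the factor 2. *)
Lemma integral_expR_norm_score_le (A : {set 'I_p}) (j : 'I_p) (t : R) :
  (forall i, subG_vec P A (fun w j => X j (W i w)) (s ^+ 2)) ->
  j \in A -> 0 < t ->
  (\int[P]_w (expR (t * `|score j w|))%:E <= (2 * expR (t ^+ 2 / 2))%:E)%E.
Proof.
move=> HA jA t0.
have side (e : R) : e ^+ 2 = t ^+ 2 ->
    (\int[P]_w (expR (e * score j w))%:E <= (expR (t ^+ 2 / 2))%:E)%E.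
  move=> e2; have := @integral_expR_score_le A (fun i => if i == j then e else 0) HA.
  rewrite (bigD1 j)//= eqxx big1 ?addr0 ?e2; last first.
    by move=> i /andP[_ /negbTE ->]; rewrite expr0n.
  apply: le_trans; rewrite le_eqVlt; apply/orP; left; apply/eqP.
  apply: eq_integral => w _; rewrite (bigD1 j)//= eqxx big1 ?addr0//.
  by move=> i /andP[_ /negbTE ->]; rewrite mul0r.
have mE (e : R) : measurable_fun setT (fun w => expR (e * score j w)).
  apply: measurableT_comp => //; apply: measurable_funM => //.
  exact: measurable_score.
apply: (@le_trans _ _ (\int[P]_w
    ((expR (t * score j w))%:E + (expR (- t * score j w))%:E))%E).
  apply: ge0_le_integral => //.
  - apply/measurable_EFinP; apply: measurableT_comp => //.
    apply: measurable_funM => //; apply: measurableT_comp => //.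
    exact: measurable_score.
  - by apply: emeasurable_funD; exact/measurable_EFinP.
  - move=> w _; rewrite -EFinD lee_fin; case: ger0P => _.
      by rewrite lerDl expR_ge0.
    by rewrite mulrN -mulNr lerDr expR_ge0.
rewrite ge0_integralD//; last 2 first.
- exact/measurable_EFinP.
- exact/measurable_EFinP.
rewrite mulr_natl mulr2n EFinD; apply: leeD; first exact: side.
by apply: side; rewrite sqrrN.
Qed.

(** The exponential of a positive part is at most 1 plus the exponential. Truncating at 0 gives the
    nonnegative variables that the concentration event takes. *)
Lemma integral_expR_excess_le (G : nat) (grp : 'I_p -> 'I_G) (g : 'I_G) (t : R) :
  (forall i, subG_vec P [set j | grp j == g] (fun w j => X j (W i w)) (s ^+ 2)) ->
  (0 < gsize grp g)%N -> 0 < t ->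
  (\int[P]_w (expR (t * Num.max 0 (grpnorm grp (score^~ w) g
                                   - Num.sqrt (gsize grp g)%:R)))%:E
    <= (2 * expR (t ^+ 2 / 2))%:E)%E.
Proof.
move=> HA g0 t0; rewrite gsizeE in g0 *.
set A := [set j | grp j == g]%SET in HA g0 *.
pose e w := t * (grpnorm grp (score^~ w) g - Num.sqrt #|A|%:R).
have NE w : grpnorm grp (score^~ w) g = Num.sqrt (\sum_(j <- enum A) score j w ^+ 2).
  by rewrite big_enum/=; congr Num.sqrt; apply: eq_bigl => j; rewrite inE.
have mN : measurable_fun setT (fun w => grpnorm grp (score^~ w) g).
  under eq_fun do rewrite NE.
  apply: measurable_fun_sqrtr; apply: measurable_sum => j.
  by apply: measurable_funX; exact: measurable_score.
have He : (\int[P]_w (expR (e w))%:E <= (expR (t ^+ 2 / 2))%:E)%E.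
  have := @integral_expR_norm_le R _ Om P _ (enum A) score t (enum_uniq _).
  rewrite -cardE => /(_ g0 t0 measurable_score) H.
  apply: le_trans (H _); last first.
    move=> v; have := @integral_expR_score_le A v HA.
    by under eq_integral do rewrite -big_enum; rewrite -big_enum.
  rewrite le_eqVlt; apply/orP; left; apply/eqP; apply: eq_integral => w _.
  by rewrite /e NE.
have me : measurable_fun setT e.
  by apply: measurable_funM => //; exact: measurable_funB.
apply: (@le_trans _ _ (\int[P]_w (cst 1%:E w + (expR (e w))%:E))%E).
  apply: ge0_le_integral => //.
  - apply/measurable_EFinP; apply: measurableT_comp => //.
    apply: measurable_funM => //; apply: measurable_maxr => //.
    exact: measurable_funB.
  - by apply: emeasurable_funD => //; apply/measurable_EFinP; exact: measurableT_comp.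
  - move=> w _; rewrite -EFinD lee_fin.
    rewrite maxr_pMr ?(ltW t0)// mulr0 -/(e w).
    by case: (lerP 0 (e w)) => _; [rewrite lerDr|rewrite expR0 lerDl expR_ge0].
rewrite ge0_integralD//; last by apply/measurable_EFinP; exact: measurableT_comp.
rewrite integral_cst// mul1e [X in (X + _ <= _)%E]probability_setT.
rewrite mulr_natl mulr2n EFinD; apply: leeD => //.
by rewrite lee_fin -expR0 ler_expR divr_ge0 ?sqr_ge0.
Qed.

End Score.

(** * The three estimators *)

Section Estimators.
Variable R : realType.

(** [b] is feasible, its norm being at most twice itself, so optimality bounds the penalty increase
    by the decrease of the empirical risk, which the subgradient inequality at [b] makes linear. *)
Lemma solves_penalty_le (Y : Type) (n p : nat) (x : 'I_n -> 'I_p -> R)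
    (y : 'I_n -> Y) (f df : R -> Y -> R) (L : R) (b bh : 'I_p -> R)
    (pen : ('I_p -> R) -> R) :
  A1 f df L ->
  solves (fun b => n%:R^-1 * \sum_(i < n) f (dotv (x i) b) (y i) + pen b)
    (norm1 b) bh ->
  pen bh - pen b <= - \sum_j
    (n%:R^-1 * \sum_(i < n) df (dotv (x i) b) (y i) * x i j) * (bh j - b j).
Proof.
move=> Hf [_ /(_ b)].
have nb0 : 0 <= norm1 b by apply: sumr_ge0.
have -> : norm1 b <= 2 * norm1 b by rewrite ler_peMl//; lra.
move=> /(_ isT) H.
have E : \sum_j (n%:R^-1 * \sum_(i < n) df (dotv (x i) b) (y i) * x i j) * (bh j - b j)
    = n%:R^-1 * \sum_(i < n) df (dotv (x i) b) (y i) * (dotv (x i) bh - dotv (x i) b).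
  under eq_bigr do rewrite -mulrA mulr_suml.
  rewrite -mulr_sumr exchange_big/=; congr (_ * _); apply: eq_bigr => i _.
  rewrite /dotv -sumrB mulr_sumr; apply: eq_bigr => j _.
  by rewrite -mulrBr mulrA.
have : n%:R^-1 * \sum_(i < n) df (dotv (x i) b) (y i) * (dotv (x i) bh - dotv (x i) b)
   <= n%:R^-1 * (\sum_(i < n) (f (dotv (x i) bh) (y i) - f (dotv (x i) b) (y i))).
  apply: ler_wpM2l; first by rewrite invr_ge0.
  by apply: ler_sum => i _; have [_ [_ [_ ]]] := Hf (y i); exact.
by rewrite E sumrB mulrBr; lra.
Qed.

(** Here [kap * S] stands for the averaged subgradient and [alpha * (kap * B)] for the tuning
    parameter. Pairing [S] with [h] costs [B] times the l2 norm on [J], weighted by [sqrt k], plus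
    [B] times the l1 norm off [J]. *)
Lemma lasso_cone (p : nat) (b bh S : 'I_p -> R) (alpha kap B : R) (J : {set 'I_p}) :
  let h := fun j => bh j - b j in
  1 < alpha -> 0 < kap -> 0 < B -> (0 < norm0 b)%N ->
  #|J| = norm0 b ->
  (forall j j', j \in J -> j' \notin J -> `|h j'| <= `|h j|) ->
  (forall A : {set 'I_p}, #|A| = norm0 b ->
     \sum_(j in A) `|S j| ^+ 2 <= (norm0 b)%:R * B ^+ 2) ->
  alpha * (kap * B) * norm1 bh - alpha * (kap * B) * norm1 b
    <= kap * - (\sum_j S j * h j) ->
  Lambda_cone J (alpha / (alpha - 1)) (Num.sqrt (norm0 b)%:R / (alpha - 1)) h.
Proof.
move=> h a1 kap0 B0 k0 Jk Jtop HA H.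
have Hrear := @sum_mul_le_top R p (fun j => `|S j|) (fun j => `|h j|) (norm0 b) B J
  k0 (ltW B0) (fun=> normr_ge0 _) (fun=> normr_ge0 _) Jk Jtop HA.
rewrite /Lambda_cone [X in _ <= _ + X]mulrAC.
have -> : \sum_(j in J) h j ^+ 2 = \sum_(j in J) `|h j| ^+ 2.
  by apply: eq_bigr => j _; rewrite -normrX ger0_norm// sqr_ge0.
apply: (@cone_of_penalty R p J [set j | b j != 0]%SET
    (fun j => `|b j|) (fun j => `|bh j|)) => //.
- by rewrite Jk norm0E.
- move=> j _; rewrite lerBlDr /h -{1}[b j](subKr (bh j)).
  exact: ler_normB.
- by move=> j; rewrite inE negbK /h => /eqP ->; rewrite normr0 add0r subr0.
have kB0 : 0 < kap * B by rewrite mulr_gt0.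
rewrite -(ler_pM2l kB0).
apply: (@le_trans _ _ (kap * - \sum_j S j * h j)).
  by apply: le_trans H; rewrite /norm1; lra.
rewrite -mulrA; apply: ler_wpM2l; first exact: ltW.
apply: le_trans Hrear; rewrite -sumrN; apply: ler_sum => j _.
by rewrite -normrM; apply: le_trans (ler_norm _) _; rewrite normrN.
Qed.

(** The score is dominated by the weights [B * lamseq p j] in the sorted sense, so its pairing with
    [h] is at most [B * slope_norm h]. With [P1] and [P2] the head and tail of that norm, this
    yields [alpha * (P2 - P1) <= P1 + P2]. *)
Lemma slope_cone (p : nat) (b bh S : 'I_p -> R) (alpha kap B : R) :
  let h := fun j => bh j - b j in
  1 < alpha -> 0 < kap -> 0 < B ->
  (forall A : {set 'I_p}, (0 < #|A|)%N ->
     \sum_(j in A) `|S j| ^+ 2 <= #|A|%:R * (B * lamseq p #|A|) ^+ 2) ->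
  alpha * (kap * B) * slope_norm bh - alpha * (kap * B) * slope_norm b
    <= kap * - (\sum_j S j * h j) ->
  Gamma_cone (norm0 b) ((alpha + 1) / (alpha - 1)) h.
Proof.
move=> h a1 kap0 B0 HA H.
have kp : (norm0 b <= p)%N.
  by rewrite norm0E -[X in (_ <= X)%N]card_ord max_card.
have Hdual : \sum_j `|S j| * `|h j| <=
    \sum_(0 <= i < p) (B * lamseq p i.+1) * nth 0 (sorted_abs h) i.
  apply: (@sum_mul_le_decr R p (fun j => `|S j|) (fun j => `|h j|)) => // A.
  have [A0|A0] := posnP #|A|.
    by rewrite A0 big_geq//; move/eqP: A0; rewrite cards_eq0 => /eqP ->; rewrite big_set0.
  have Ap : (#|A| <= p)%N by rewrite -[X in (_ <= X)%N]card_ord max_card.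
  have p0 : (0 < p)%N by exact: leq_trans Ap.
  have lam0 : 0 < lamseq p #|A| :> R by rewrite lamseq_gt0// A0.
  (* As [lamseq] is nonincreasing, its value at [#|A|] is at most the average of the values before
     it; Cauchy-Schwarz turns the bound on squares into one on the sum. *)
  apply: (@le_trans _ _ (#|A|%:R * (B * lamseq p #|A|))); last first.
    rewrite mulr_natl -[X in _ *+ X]subn0 -sumr_const_nat.
    apply: ler_sum_nat => i /andP[_ iA]; apply: ler_wpM2l; first exact: ltW.
    by apply: lamseq_le.
  have := @cauchy_schwarz_sum R _ (index_enum 'I_p) (mem A) (fun j => `|S j|) (fun=> 1).
  under eq_bigr do rewrite mulr1.
  move=> /le_trans; apply.
  rewrite [X in _ * Num.sqrt X](_ : _ = #|A|%:R); last first.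
    by under eq_bigr do rewrite expr1n; rewrite sumr_const.
  apply: (@le_trans _ _ (Num.sqrt (#|A|%:R * (B * lamseq p #|A|) ^+ 2) * Num.sqrt #|A|%:R)).
    by apply: ler_wpM2r; [exact: sqrtr_ge0|rewrite ler_wsqrtr// HA].
  rewrite sqrtrM ?ler0n// sqrtr_sqr ger0_norm ?mulr_ge0 ?(ltW B0) ?(ltW lam0)//.
  by rewrite mulrAC -expr2 sqr_sqrtr.
have HS : kap * - (\sum_j S j * h j) <= kap * (B * slope_norm h).
  apply: ler_wpM2l; first exact: ltW.
  rewrite /slope_norm /slope_part mulr_sumr.
  under [leRHS]eq_bigr do rewrite mulrA.
  apply: le_trans Hdual; rewrite -sumrN; apply: ler_sum => j _.
  by rewrite -normrM; apply: le_trans (ler_norm _) _; rewrite normrN.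
have Hdiff := @weighted_decr_diff_le R p (fun i => lamseq p i.+1) b bh.
have {Hdiff} : slope_norm b - slope_norm bh <=
    slope_part h 0 (norm0 b) - slope_part h (norm0 b) p.
  apply: Hdiff.
  - by move=> i j /andP[ij jp]; apply: lamseq_le; rewrite ?ltnS// (leq_ltn_trans _ jp).
  - by move=> i ip; rewrite ltW// lamseq_gt0.
have hE : slope_norm h = slope_part h 0 (norm0 b) + slope_part h (norm0 b) p.
  by rewrite /slope_norm /slope_part (big_cat_nat (n := norm0 b)).
rewrite hE in HS.
set P1 := slope_part h 0 _ in HS *; set P2 := slope_part h _ p in HS * => Hdiff.
have kB0 : 0 < kap * B by rewrite mulr_gt0.
have H1 : alpha * (slope_norm bh - slope_norm b) <= P1 + P2.
  rewrite -(ler_pM2l kB0); apply: le_trans (le_trans HS _); last by rewrite mulrA.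
  by apply: le_trans H; lra.
have a1' : 0 < alpha - 1 by rewrite subr_gt0.
rewrite /Gamma_cone -/P1 -/P2 mulrAC ler_pdivlMr//.
have : alpha * (P2 - P1) <= alpha * (slope_norm bh - slope_norm b).
  by rewrite ler_pM2l//; lra.
by lra.
Qed.

(** Cauchy-Schwarz inside each group reduces the pairing to group norms; from there the argument is
    that of the Lasso, with groups for coordinates. *)
Lemma group_lasso_cone (p G : nat) (grp : 'I_p -> 'I_G) (b bh S : 'I_p -> R)
    (alpha kap B : R) (J : {set 'I_G}) :
  let h := fun j => bh j - b j in
  1 < alpha -> 0 < kap -> 0 < B -> (0 < #|Jsupp grp b|)%N ->
  #|J| = #|Jsupp grp b| ->
  (forall g g', g \in J -> g' \notin J -> grpnorm grp h g' <= grpnorm grp h g) ->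
  (forall A : {set 'I_G}, #|A| = #|Jsupp grp b| ->
     \sum_(g in A) grpnorm grp S g ^+ 2 <= #|Jsupp grp b|%:R * B ^+ 2) ->
  alpha * (kap * B) * (\sum_(g < G) grpnorm grp bh g)
      - alpha * (kap * B) * (\sum_(g < G) grpnorm grp b g)
    <= kap * - (\sum_j S j * h j) ->
  Omega_cone grp J (alpha / (alpha - 1))
    (Num.sqrt #|Jsupp grp b|%:R / (alpha - 1)) h.
Proof.
move=> h a1 kap0 B0 k0 Jk Jtop HA H.
have Hrear := @sum_mul_le_top R G (grpnorm grp S) (grpnorm grp h) _ B J
  k0 (ltW B0) (grpnorm_ge0 _ _ _ _ _) (grpnorm_ge0 _ _ _ _ _) Jk Jtop HA.
rewrite /Omega_cone [X in _ <= _ + X]mulrAC -sum_sqr_grpnorm.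
apply: (@cone_of_penalty R G J (Jsupp grp b) (grpnorm grp b) (grpnorm grp bh)) => //.
- by move=> g _; rewrite lerBlDr; exact: grpnorm_le_add.
- move=> g; rewrite inE => /existsPn gb.
  have b0 j : grp j == g -> b j = 0.
    by move=> gj; have := gb j; rewrite gj/= negbK => /eqP.
  rewrite {1}/grpnorm big1 ?sqrtr0 ?add0r; last first.
    by move=> j /b0 ->; rewrite expr0n.
  rewrite le_eqVlt; apply/orP; left; apply/eqP; congr Num.sqrt.
  by apply: eq_bigr => j /b0 bj; rewrite /h bj subr0.
have kB0 : 0 < kap * B by rewrite mulr_gt0.
rewrite -(ler_pM2l kB0).
apply: (@le_trans _ _ (kap * - \sum_j S j * h j)).
  by apply: le_trans H; lra.
rewrite -mulrA; apply: ler_wpM2l; first exact: ltW.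
apply: le_trans Hrear.
have := sum_mul_le_grpnorm R p G grp (fun j => - S j) h.
under eq_bigr do rewrite mulNr.
by rewrite sumrN; under [leRHS]eq_bigr do rewrite grpnormN.
Qed.

End Estimators.

Theorem theorem1 (R : realType)
  (dO : measure_display) (Om : measurableType dO) (P : probability Om R)
  (dZ : measure_display) (Z : measurableType dZ) (mu : probability Z R)
  (Y : Type) (n p G : nat)
  (phi : Z -> 'I_p -> R) (psi : Z -> Y) (W : 'I_n -> Om -> Z)
  (f df : R -> Y -> R) (L M delta alpha gamma : R)
  (bstar : 'I_p -> R) (grp : 'I_p -> 'I_G) :
  (0 < n)%N ->
  0 < delta < 1 ->
  2 <= alpha ->
  0 < L -> 0 < M ->
  A1 f df L ->
  (* (x_i, y_i) = (phi (W i), psi (W i)) are independent draws from mu *)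
  (forall i, measurable_fun setT (W i)) ->
  (forall i (A : set Z), measurable A -> P (W i @^-1` A) = mu A) ->
  mutually_indep P W ->
  (* beta* minimizes the population risk E f(<x,beta>; y) *)
  (forall b : 'I_p -> R,
     (\int[mu]_z (f (dotv (phi z) bstar) (psi z))%:E
        <= \int[mu]_z (f (dotv (phi z) b) (psi z))%:E)%E) ->
  (0 < norm0 bstar)%N ->
  (* the subgradient terms are measurable functions of an observation *)
  (forall j, measurable_fun setT
               (fun z => df (dotv (phi z) bstar) (psi z) * phi z j)) ->
  (* Assumption (SG) *)
  (forall i j, subG P
     (fun w => df (dotv (phi (W i w)) bstar) (psi (W i w)) * phi (W i w) j)
     (L ^+ 2 * M ^+ 2)) ->
  (forall i (g : 'I_G), subG_vec P [set j | grp j == g]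
     (fun w j => df (dotv (phi (W i w)) bstar) (psi (W i w)) * phi (W i w) j)
     (L ^+ 2 * M ^+ 2)) ->
  (* the groups form a partition of {1..p} into nonempty blocks *)
  (forall g : 'I_G, exists j, grp j = g) ->
  1 <= gamma ->
  (m0_of grp #|Jsupp grp bstar|)%:R
     <= gamma * (\sum_(g in Jsupp grp bstar) gsize grp g)%:R ->
  let kstar := norm0 bstar in
  let Rad := norm1 bstar in
  let Jstar := Jsupp grp bstar in
  let sstar := #|Jstar| in
  let mstar := (\sum_(g in Jstar) gsize grp g)%N in
  let eta := 12 * alpha * L * M * Num.sqrt (ln (2 / delta) / n%:R) in
  let lam := eta * lamseq p kstar in
  let lamG := eta * lamseq G sstar
              + alpha * L * M * Num.sqrt (gamma * mstar%:R / (sstar%:R * n%:R)) in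
  let emp := fun (w : Om) (b : 'I_p -> R) =>
    n%:R^-1 * \sum_(i < n) f (dotv (phi (W i w)) b) (psi (W i w)) in
  (* (1) Lasso *)
  (exists E : set Om, measurable E /\ ((1 - delta / 2)%:E <= P E)%E /\
    forall w, E w ->
    forall bh : 'I_p -> R,
      solves (fun b => emp w b + lam * norm1 b) Rad bh ->
      let h := fun j => bh j - bstar j in
      forall S0 : {set 'I_p}, #|S0| = kstar ->
        (forall j j', j \in S0 -> j' \notin S0 -> `|h j'| <= `|h j|) ->
        Lambda_cone S0 (alpha / (alpha - 1))
                       (Num.sqrt kstar%:R / (alpha - 1)) h) /\
  (* (2) Slope *)
  (exists E : set Om, measurable E /\ ((1 - delta / 2)%:E <= P E)%E /\
    forall w, E w ->
    forall bh : 'I_p -> R,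
      solves (fun b => emp w b + eta * slope_norm b) Rad bh ->
      Gamma_cone kstar ((alpha + 1) / (alpha - 1)) (fun j => bh j - bstar j)) /\
  (* (3) group Lasso *)
  (exists E : set Om, measurable E /\ ((1 - delta / 2)%:E <= P E)%E /\
    forall w, E w ->
    forall bh : 'I_p -> R,
      solves (fun b => emp w b + lamG * \sum_(g < G) grpnorm grp b g) Rad bh ->
      let h := fun j => bh j - bstar j in
      forall J0 : {set 'I_G}, #|J0| = sstar ->
        (forall g g', g \in J0 -> g' \notin J0 -> grpnorm grp h g' <= grpnorm grp h g) ->
        Omega_cone grp J0 (alpha / (alpha - 1))
                   (Num.sqrt sstar%:R / (alpha - 1)) h).
Proof.
move=> n_gt0 delta01 alpha2 L_gt0 M_gt0 HA1 mW _ indW _ k_gt0 mX _ HG grp_surj _ Hm0.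
move=> k Rad Js s m eta lam lamG emp.
have a1 : 1 < alpha by lra.
have n0 : 0 < n%:R :> R by rewrite ltr0n.
have [d0 d1] : 0 < delta /\ delta < 1 by apply/andP.
pose X (j : 'I_p) z := df (dotv (phi z) bstar) (psi z) * phi z j.
have LM0 : 0 < L * M by rewrite mulr_gt0.
pose S w j := score R _ Om _ Z n p W X (L * M) j w.
pose kap := L * M / Num.sqrt n%:R.
have sn0 : 0 < Num.sqrt n%:R :> R by rewrite sqrtr_gt0.
have kap0 : 0 < kap by rewrite divr_gt0.
pose B0 := 12 * Num.sqrt (ln (2 / delta)).
have lnd0 : 0 < ln (2 / delta) by rewrite ln_gt0// ltr_pdivlMr//; lra.
have B0_gt0 : 0 < B0 by rewrite mulr_gt0// sqrtr_gt0.
(* [kap] converts the score into the averaged subgradient and [B0] is its level on the event, so the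
   tuning parameters are [alpha] times the noise. *)
have etaE : eta = alpha * (kap * B0).
  rewrite /eta sqrtrM ?(ltW lnd0)// sqrtrV ?ler0n// /kap /B0; ring.
have HX i (g : 'I_G) : subG_vec P [set j | grp j == g]%SET
    (fun w j => X j (W i w)) ((L * M) ^+ 2).
  by rewrite exprMn; exact: HG.
have penalty (pen : ('I_p -> R) -> R) w bh :
    solves (fun b => emp w b + pen b) Rad bh ->
    pen bh - pen bstar <= kap * - (\sum_j S w j * (bh j - bstar j)).
  move=> /(solves_penalty_le R Y n p (fun i => phi (W i w)) (fun i => psi (W i w))
    f df L bstar bh pen HA1) /le_trans; apply.
  rewrite mulrN mulr_sumr lerN2 le_eqVlt; apply/orP; left; apply/eqP.
  apply: eq_bigr => j _; rewrite mulrA; congr (_ * _).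
  rewrite /S /score mulrA; congr (_ * _).
  rewrite /kap -[in RHS](sqr_sqrtr (ltW n0)); field.
  by rewrite !gt_eqF.
have p_gt0 : (0 < p)%N.
  by apply: leq_trans k_gt0 _; rewrite norm0E -[X in (_ <= X)%N]card_ord max_card.
have k_le : (0 < k <= p)%N.
  by rewrite k_gt0/= /k norm0E -[X in (_ <= X)%N]card_ord max_card.
(* One event serves the Lasso and Slope: the former uses it for sets of size [k], the latter for all
   sizes. *)
have [E [mE PE HE]] : exists E : set Om, [/\ measurable E,
    ((1 - delta / 2)%:E <= P E)%E & forall w, E w -> forall A : {set 'I_p},
    (0 < #|A|)%N -> \sum_(j in A) `|S w j| ^+ 2 <= #|A|%:R * (B0 * lamseq p #|A|) ^+ 2].
  apply: (@exists_event_sum_sqr_le R _ Om P p (fun j w => `|S w j|)) => //.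
  - by move=> j; apply: measurableT_comp => //; exact: measurable_score.
  - move=> j t t0; apply: (@integral_expR_norm_score_le R _ Om P _ Z n p W X (L * M)
      n_gt0 LM0 mW indW mX [set i | grp i == grp j]%SET j t) => //.
    by rewrite inE.
split; [|split].
- exists E; split=> //; split=> // w Ew bh Hbh h S0 S0k S0top.
  have B_gt0 : 0 < B0 * lamseq p k by rewrite mulr_gt0// lamseq_gt0.
  apply: (@lasso_cone R p bstar bh (S w) alpha kap (B0 * lamseq p k)) => //.
    by move=> A Ak; have := HE w Ew A; rewrite Ak; exact.
  have := penalty (fun b => lam * norm1 b) w bh Hbh.
  by rewrite /lam etaE !mulrA.
- exists E; split=> //; split=> // w Ew bh Hbh.
  apply: (@slope_cone R p bstar bh (S w) alpha kap B0) => //; first exact: HE.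
  by have := penalty (fun b => eta * slope_norm b) w bh Hbh; rewrite etaE.
have s_gt0 : (0 < s)%N.
  move: k_gt0; rewrite norm0E => /card_gt0P[j]; rewrite inE => bj.
  by apply/card_gt0P; exists (grp j); rewrite inE; apply/existsP; exists j; rewrite eqxx.
have s_le : (s <= G)%N by rewrite -[X in (_ <= X)%N]card_ord max_card.
have s0 : 0 < s%:R :> R by rewrite ltr0n.
have gs_gt0 g : (0 < gsize grp g)%N.
  rewrite gsizeE; apply/card_gt0P; have [j gj] := grp_surj g.
  by exists j; rewrite inE gj.
pose U g w := Num.max 0 (grpnorm grp (S w) g - Num.sqrt (gsize grp g)%:R).
have [E' [mE' PE' HE']] : exists E : set Om, [/\ measurable E,
    ((1 - delta / 2)%:E <= P E)%E & forall w, E w -> forall A : {set 'I_G},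
    (0 < #|A|)%N -> \sum_(g in A) U g w ^+ 2 <= #|A|%:R * (B0 * lamseq G #|A|) ^+ 2].
  apply: (@exists_event_sum_sqr_le R _ Om P G U) => //.
  - exact: leq_trans s_le.
  - move=> g; apply: measurable_maxr => //; apply: measurable_funB => //.
    rewrite /grpnorm; apply: measurable_fun_sqrtr.
    under eq_fun do rewrite -big_filter.
    by apply: measurable_sum => j; apply: measurable_funX; exact: measurable_score.
  - by move=> g w; rewrite le_max lexx.
  - by move=> g t t0; apply: integral_expR_excess_le.
exists E'; split=> //; split=> // w Ew bh Hbh h J0 J0s J0top.
(* The second term of [lamG] is [alpha * kap * r]; [r] accounts for the typical sizes [sqrt n_g],
   and [B0 * lamseq G s] for the excesses [U]. *)
pose r := Num.sqrt (gamma * m%:R / s%:R).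
have gm0 : 0 <= gamma * m%:R by apply: le_trans Hm0; exact: ler0n.
pose B := B0 * lamseq G s + r.
have B_gt0 : 0 < B.
  by rewrite ltr_pwDl ?sqrtr_ge0// mulr_gt0// lamseq_gt0// s_gt0.
apply: (@group_lasso_cone R p G grp bstar bh (S w) alpha kap B) => //; last first.
  have := penalty (fun b => lamG * \sum_(g < G) grpnorm grp b g) w bh Hbh.
  have -> // : lamG = alpha * (kap * B).
  rewrite /lamG etaE.
  have -> : gamma * m%:R / (s%:R * n%:R) = gamma * m%:R / s%:R * n%:R^-1.
    by rewrite invfM mulrA.
  rewrite [Num.sqrt (_ * n%:R^-1)]sqrtrM ?divr_ge0 ?(ltW s0)// sqrtrV ?ler0n//.
  by rewrite -/r /B /kap; ring.
move=> A As.
set v := B0 * lamseq G s.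
have v0 : 0 <= v by rewrite mulr_ge0 ?(ltW B0_gt0)// sqrtr_ge0.
have r0 : 0 <= r by exact: sqrtr_ge0.
have HU : \sum_(g in A) U g w ^+ 2 <= s%:R * v ^+ 2.
  by have := HE' w Ew A; rewrite As; exact.
(* Any [s] groups have total size at most [m0_of grp s], hence at most [gamma * m], which is
   [s * r ^+ 2]. *)
have Hn : \sum_(g in A) Num.sqrt (gsize grp g)%:R ^+ 2 <= s%:R * r ^+ 2.
  rewrite sqr_sqrtr ?divr_ge0 ?(ltW s0)// mulrC divfK ?gt_eqF//.
  apply: le_trans Hm0; under eq_bigr do rewrite sqr_sqrtr ?ler0n//.
  rewrite -natr_sum ler_nat /m0_of.
  by apply: (@leq_bigmax_cond _ _ (fun J : {set 'I_G} => \sum_(g in J) gsize grp g)%N);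
    apply/eqP.
have HS g : grpnorm grp (S w) g <= Num.sqrt (gsize grp g)%:R + U g w.
  by rewrite -lerBlDl le_max lexx orbT.
rewrite -/s -[X in _ <= X]sqr_sqrtr; last by rewrite mulr_ge0 ?sqr_ge0.
rewrite -[X in X <= _]sqr_sqrtr; last by apply: sumr_ge0 => g _; exact: sqr_ge0.
rewrite ler_sqr ?nnegrE ?sqrtr_ge0//.
apply: (@le_trans _ _ (Num.sqrt (\sum_(g in A) (Num.sqrt (gsize grp g)%:R + U g w) ^+ 2))).
  rewrite ler_wsqrtr//; apply: ler_sum => g _.
  rewrite ler_sqr ?nnegrE ?grpnorm_ge0//.
  by apply: le_trans (HS g); exact: grpnorm_ge0.
(* In the l2 norm over [A] the sizes contribute [sqrt s * r] and the excesses [sqrt s * v], adding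
   up to [sqrt s * B]. *)
apply: le_trans (minkowski_sum _ _ _ _ _ _) _.
apply: (@le_trans _ _ (Num.sqrt (s%:R * r ^+ 2) + Num.sqrt (s%:R * v ^+ 2))).
  by apply: lerD; rewrite ler_wsqrtr.
rewrite !(sqrtrM _ (ltW s0)) !sqrtr_sqr !ger0_norm ?(ltW B_gt0)//.
by rewrite -mulrDr addrC.
Qed.
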